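(* Let $\sigma\in M^0_{\rho,\Lambda}(\mathbb{T}\times\mathbb{Z})$. Then $T_\sigma$ is a compact operator on $L^2(\mathbb{T})$ if and only if $d=0$, where $$d=\limsup_{|k|\to\infty}\Big\{\sup_{x\in[-\pi,\pi]}|\sigma(x,k)|\Big\}.$$
   Context: $\mathbb{N}_0=\{0,1,2,\dots\}$, and $\mathbb{T}=\mathbb{R}/2\pi\mathbb{Z}$ is the one-dimensional torus, identified with $[-\pi,\pi]$ with endpoints identified. For a function $a$ of $k\in\mathbb{Z}$, $\Delta_k a(k)=a(k+1)-a(k)$ and $\Delta_k^\alpha$ is its $\alpha$-th iterate. Weight function: $\Lambda:\mathbb{Z}\to(0,\infty)$ is a fixed function for which there are positive constants $\mu_0\le\mu_1$, $C_0,C_1$ with $C_0(1+|k|)^{\mu_0}\le\Lambda(k)\le C_1(1+|k|)^{\mu_1}$ for all $k\in\mathbb{Z}$. Moreover there is a real constant $\mu\ge\mu_1$ such that for all $\alpha\in\mathbb{N}_0$ and $\gamma\in\{0,1\}$ there is $C_{\alpha,\gamma}>0$ with $|k^\gamma\Delta_k^{\alpha+\gamma}\Lambda(k)|\le C_{\alpha,\gamma}\Lambda(k)^{1-\alpha/\mu}$ for all $k\in\mathbb{Z}$. Fix $\rho\in(0,1/\mu]$. Symbol classes: for $m\in\mathbb{R}$, $S^m_{\rho,\Lambda}(\mathbb{T}\times\mathbb{Z})$ is the set of functions $\sigma:\mathbb{T}\times\mathbb{Z}\to\mathbb{C}$, smooth in $x$ for every $k\in\mathbb{Z}$, such that for all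 $\alpha,\beta\in\mathbb{N}_0$ there is $C_{\alpha,\beta}>0$ with $|\Delta_k^\alpha\partial_x^\beta\sigma(x,k)|\le C_{\alpha,\beta}\Lambda(k)^{m-\rho\alpha}$ for all $(x,k)\in\mathbb{T}\times\mathbb{Z}$. $M^m_{\rho,\Lambda}(\mathbb{T}\times\mathbb{Z})$ is the set of functions $\sigma:\mathbb{T}\times\mathbb{Z}\to\mathbb{C}$, smooth in $x$ for every $k$, such that $k^\gamma\Delta_k^\gamma\sigma(x,k)\in S^m_{\rho,\Lambda}(\mathbb{T}\times\mathbb{Z})$ for each $\gamma\in\{0,1\}$. The pseudo-differential operator with symbol $\sigma$ is $$T_\sigma f(x)=(2\pi)^{-1}\sum_{k\in\mathbb{Z}}\int_{\mathbb{T}}e^{i(x-y)k}\sigma(x,k)f(y)\,dy,\quad x\in\mathbb{T},\ f\in C^\infty(\mathbb{T}).$$ For $\sigma\in M^0_{\rho,\Lambda}(\mathbb{T}\times\mathbb{Z})$ it extends to a bounded linear operator on $L^2(\mathbb{T})$, still denoted $T_\sigma$. *)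

(* Defs.v *)
From HB Require Import structures.
From mathcomp Require Export all_boot all_order all_algebra.
From mathcomp Require Export complex.
From mathcomp Require Export all_classical all_reals all_analysis.

Set Implicit Arguments.
Unset Strict Implicit.
Unset Printing Implicit Defensive.

Import Order.TTheory GRing.Theory Num.Theory numFieldNormedType.Exports.
Import ComplexField.Normc.

Local Open Scope classical_set_scope.
Local Open Scope ring_scope.
Local Open Scope complex_scope.

(* Functions on the torus are 2 pi-periodic functions of a real variable, and
   [-pi, pi] is used as fundamental domain for integrals and suprema. *)

Section ComplexValued.
Context {R : realType}.
Implicit Types (f : R -> R[i]) (u : nat -> R[i]).

(* The derivatives, integrals and limits of complex-valued functions are
   taken separately on the real and imaginary parts. *)
Definition cderiv (n : nat) f (x : R) : R[i] :=
  derive1n n (@complex.Re R \o f) x +i* derive1n n (@complex.Im R \o f) x.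

Definition csmooth f : Prop := forall (n : nat) (x : R),
  derivable (derive1n n (@complex.Re R \o f)) x 1 /\
  derivable (derive1n n (@complex.Im R \o f)) x 1.

Definition periodic2pi f : Prop := forall x : R, f (x + 2 * pi) = f x.

Definition smooth_torus f : Prop := periodic2pi f /\ csmooth f.

Definition torus_integral f : R[i] :=
  Rintegral (@lebesgue_measure R) `[- pi, pi] (@complex.Re R \o f)
  +i* Rintegral (@lebesgue_measure R) `[- pi, pi] (@complex.Im R \o f).

Definition clim u : R[i] :=
  lim ((@complex.Re R \o u) @ \oo) +i* lim ((@complex.Im R \o u) @ \oo).

(* Sum over the integers, as the limit of the symmetric partial sums
   a (- n) + ... + a n. *)
Definition sum_int (a : int -> R[i]) : R[i] :=
  clim (fun n => \sum_(j < n.*2.+1) a (j%:Z - n%:Z)).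

Definition expi (t : R) : R[i] := cos t +i* sin t.

End ComplexValued.

Definition Delta {V : zmodType} (a : int -> V) : int -> V :=
  fun k => a (k + 1) - a k.

Section Symbols.
Context {R : realType}.

(* mu0 and mu1 are the growth exponents of Lambda, and mu >= mu1 is the exponent
   in the bounds on its differences. *)
Definition weight_function (Lambda : int -> R) (mu0 mu1 mu : R) : Prop :=
  [/\ forall k, 0 < Lambda k,
      0 < mu0 <= mu1,
      exists C0 C1 : R, [/\ 0 < C0, 0 < C1 &
        forall k : int, C0 * (1 + `|k|%:~R) `^ mu0 <= Lambda k
                  <= C1 * (1 + `|k|%:~R) `^ mu1],
      mu1 <= mu &
      forall alpha gamma : nat, (gamma <= 1)%N ->
        exists2 C : R, 0 < C & forall k : int,
          `| k%:~R ^+ gamma * iter (alpha + gamma) Delta Lambda k |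
          <= C * Lambda k `^ (1 - alpha%:R / mu)].

Definition symbolS (Lambda : int -> R) (rho m : R) (sigma : R -> int -> R[i])
    : Prop :=
  (forall k, smooth_torus (sigma ^~ k)) /\
  (forall alpha beta : nat, exists2 C : R, 0 < C & forall (x : R) (k : int),
     normc (iter alpha Delta (fun j => cderiv beta (sigma ^~ j) x) k)
     <= C * Lambda k `^ (m - rho * alpha%:R)).

Definition symbolM (Lambda : int -> R) (rho m : R) (sigma : R -> int -> R[i])
    : Prop :=
  (forall k, smooth_torus (sigma ^~ k)) /\
  (forall gamma : nat, (gamma <= 1)%N ->
     symbolS Lambda rho m
       (fun x k => k%:~R ^+ gamma * iter gamma Delta (sigma x) k)).

Definition pseudo_diff (sigma : R -> int -> R[i]) (f : R -> R[i]) (x : R)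
    : R[i] :=
  ((2 * pi)^-1)%:C * sum_int (fun k => torus_integral
    (fun y => expi ((x - y) * k%:~R) * sigma x k * f y)).

Definition sup_norm_torus (f : R -> R[i]) : \bar R :=
  ereal_sup [set (normc (f x))%:E | x in `[- pi, pi]].

(* limsup as |k| -> oo, i.e. the infimum over N of the suprema over |k| >= N
   (the library's limf_esup is not available here: int is no filteredType). *)
Definition limsup_int_infty (a : int -> \bar R) : \bar R :=
  ereal_inf [set ereal_sup [set a k | k in [set k : int | (N <= absz k)%N]]
            | N in [set: nat]].

Definition symbol_limsup (sigma : R -> int -> R[i]) : \bar R :=
  limsup_int_infty (fun k => sup_norm_torus (sigma ^~ k)).

End Symbols.

Section L2.
Context {R : realType}.
Implicit Types (f g : R -> R[i]) (T : (R -> R[i]) -> (R -> R[i])).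

Definition torus_measure :=
  mrestr (@lebesgue_measure R) (measurable_itv `[- pi, pi]).

HB.instance Definition _ := Measure.on torus_measure.

(* Elements of L^2 are represented by functions, and equality in L^2 is equality
   almost everywhere for torus_measure; the values taken outside [-pi, pi] are
   therefore irrelevant. *)
Definition inL2 f : Prop :=
  (@complex.Re R \o f) \in Lfun torus_measure 2%:E /\
  (@complex.Im R \o f) \in Lfun torus_measure 2%:E.

Definition eqL2 f g : Prop := {ae torus_measure, forall x, f x = g x}.

Definition normL2 f : \bar R :=
  Lnorm torus_measure 2%:E (fun x => (normc (f x))%:E).

(* Linearity and boundedness imply that T is compatible with eqL2. *)
Definition bounded_linear_operator T : Prop :=
  [/\ forall f, inL2 f -> inL2 (T f),
      forall (a : R[i]) f g, inL2 f -> inL2 g ->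
        eqL2 (T (fun x => a * f x + g x)) (fun x => a * T f x + T g x) &
      exists C : R, forall f, inL2 f -> (normL2 (T f) <= C%:E * normL2 f)%E].

Definition bounded_extension (sigma : R -> int -> R[i]) T : Prop :=
  bounded_linear_operator T /\
  (forall f, smooth_torus f -> eqL2 (T f) (pseudo_diff sigma f)).

(* Every bounded sequence has a subsequence whose image converges in L^2. *)
Definition compact_operator T : Prop :=
  forall u : nat -> R -> R[i],
    (forall n, inL2 (u n)) ->
    (exists C : R, forall n, (normL2 (u n) <= C%:E)%E) ->
    exists (phi : nat -> nat) (g : R -> R[i]),
      [/\ increasing_seq phi, inL2 g &
          normL2 (fun x => T (u (phi n)) x - g x) @[n --> \oo] --> 0%E].

End L2.

(* Main.v *)
From HB Require Import structures.
Require Import Defs.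
From mathcomp Require Import ring lra zify.
From mathcomp Require Import measurable_realfun.
Set Implicit Arguments.
Unset Strict Implicit.
Unset Printing Implicit Defensive.
Import Order.TTheory GRing.Theory Num.Theory numFieldNormedType.Exports.
Import ComplexField.Normc.
Local Open Scope classical_set_scope.
Local Open Scope ring_scope.
Local Open Scope complex_scope.

(** Write e_k for the character x |-> e^(ikx).  On a character the operator is
    multiplication by the symbol, T e_k = sigma(., k) e_k, so a trigonometric
    polynomial sum_k c_k e_k is sent to sum_k c_k sigma(., k) e_k, and the
    trigonometric polynomials are dense in L^2.  The symbol enters through
    bounds, uniform in k, on sigma and on its x-derivative sigma'.

    Both directions rest on the one-dimensional Sobolev inequality
    [sobolev_torus]: for every h > 0 and x in [-pi, pi],
      2 pi |f(x)|^2 <= (1 + 2 pi / h) int |f|^2 + 2 pi h int |f'|^2.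

    If d = 0, apply the inequality, for fixed x, to the function
    y |-> sum_k c_k sigma(y, k) e_k(x), evaluate it at y = x and integrate in x.
    The double integrals are computed by Tonelli and Parseval in the variable
    x, which gives [symbol_sum_bound]: if |sigma|^2 <= A and |sigma'|^2 <= C on
    the frequencies involved, then
      int |sum_k c_k sigma(x, k) e_k(x)|^2 dx
        <= 2 pi ((1 + 2 pi / h) A + 2 pi h C) sum_k |c_k|^2.
    Choosing first h and then A small, T is small on polynomials with high
    frequencies.  Given a bounded sequence of L^2, approximate its n-th term in
    square mean up to 1 / (n+1) by a trigonometric polynomial, and extract a
    subsequence along which every coefficient converges.  The images of the
    differences are small on the high frequencies by the above, and on the
    finitely many remaining ones because the coefficients converge.  So the
    images form a Cauchy sequence, and L^2 is complete.

    If d > 0, there are a constant e > 0 and infinitely many k for which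
    |sigma(., k)|^2 exceeds e somewhere on [-pi, pi]; since sigma' is bounded,
    the Sobolev inequality turns this into a lower bound on
    int |T e_k|^2 = int |sigma(., k)|^2.  If T were compact, T e_k would converge
    to some g <> 0 along a sequence of such k.  But the sum of M characters has
    squared norm 2 pi M, so the average of M of the T e_k has squared norm
    O(1 / M), while it is close to g: a contradiction.

    Convergence is measured by the square integral [sqint] instead of the norm:
    |a + b|^2 <= 2 |a|^2 + 2 |b|^2 then plays the role of the triangle
    inequality. *)

(** * The squared modulus of a complex number *)

Section SquaredModulus.
Context {R : realType}.
Implicit Types z w : R[i].

Definition sqnorm z : R := complex.Re z ^+ 2 + complex.Im z ^+ 2.

Lemma sqnorm_ge0 z : 0 <= sqnorm z.
Proof. by rewrite addr_ge0// sqr_ge0. Qed.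

Lemma sqr_normc z : normc z ^+ 2 = sqnorm z.
Proof. by case: z => a b; rewrite /= sqr_sqrtr// addr_ge0// sqr_ge0. Qed.

Lemma sqnormM z w : sqnorm (z * w) = sqnorm z * sqnorm w.
Proof. by case: z => a b; case: w => c d; rewrite /sqnorm /=; ring. Qed.

Lemma sqnormN z : sqnorm (- z) = sqnorm z.
Proof. by case: z => a b; rewrite /sqnorm /=; ring. Qed.

Lemma sqnorm_distC z w : sqnorm (z - w) = sqnorm (w - z).
Proof. by rewrite -sqnormN opprB. Qed.

Lemma sqnorm0 : sqnorm 0 = 0.
Proof. by rewrite /sqnorm /= expr0n addr0. Qed.

(** Stands in for the triangle inequality: the factor 2 is harmless, and no
    square roots occur. *)
Lemma sqnormD_le z w : sqnorm (z + w) <= 2 * sqnorm z + 2 * sqnorm w.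
Proof.
case: z => a b; case: w => c d; rewrite /sqnorm /=.
have := sqr_ge0 (a - c); have := sqr_ge0 (b - d); nra.
Qed.

Lemma sqnorm_natr n : sqnorm (n%:R : R[i]) = n%:R ^+ 2.
Proof.
rewrite -(rmorph_nat (real_complex R)) /sqnorm /=.
by rewrite expr0n addr0.
Qed.

Lemma sqnorm_sum_le n (F : nat -> R[i]) :
  sqnorm (\sum_(j < n) F j) <= n%:R * \sum_(j < n) sqnorm (F j).
Proof.
elim: n => [|n IHn]; first by rewrite !big_ord0 mul0r sqnorm0.
rewrite !big_ord_recr /=.
case: n IHn => [_|n IHn]; first by rewrite !big_ord0 !add0r mul1r.
set S := \sum_(_ < _) _ in IHn *; set t := \sum_(_ < _) _ in IHn *.
set z := F n.+1.
(* The inductive step is the convexity bound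
   |S + z|^2 <= (n+2) (|S|^2/(n+1) + |z|^2). *)
have n0 : 0 < (n.+1%:R : R) by rewrite ltr0n.
have key : sqnorm (S + z) <= (n.+2%:R) * (sqnorm S / n.+1%:R + sqnorm z).
  case: S IHn => a b _; case: z => c d; rewrite /sqnorm /=.
  have -> : (n.+2%:R : R) = n.+1%:R + 1 by rewrite -[n.+2%:R]natr1.
  rewrite -subr_ge0.
  set N := (n.+1%:R : R) in n0 *.
  have -> : (N + 1) * ((a ^+ 2 + b ^+ 2) / N + (c ^+ 2 + d ^+ 2)) -
    ((a + c) ^+ 2 + (b + d) ^+ 2) =
    ((a - N * c) ^+ 2 + (b - N * d) ^+ 2) / N by field; rewrite gt_eqF.
  by rewrite divr_ge0 ?(ltW n0)// addr_ge0 ?sqr_ge0.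
apply: (le_trans key); rewrite ler_wpM2l// lerD2r ler_pdivrMr//.
by rewrite mulrC.
Qed.

Lemma cRe_sum n (F : nat -> R[i]) :
  complex.Re (\sum_(j < n) F j) = \sum_(j < n) complex.Re (F j).
Proof. by rewrite (raddf_sum (@complex.Re R : {additive R[i] -> R})). Qed.

Lemma cIm_sum n (F : nat -> R[i]) :
  complex.Im (\sum_(j < n) F j) = \sum_(j < n) complex.Im (F j).
Proof. by rewrite (raddf_sum (@complex.Im R : {additive R[i] -> R})). Qed.

Lemma cReM z w : complex.Re (z * w) =
  complex.Re z * complex.Re w - complex.Im z * complex.Im w.
Proof. by case: z => ? ?; case: w. Qed.

Lemma cImM z w : complex.Im (z * w) =
  complex.Re z * complex.Im w + complex.Im z * complex.Re w.
Proof. by case: z => ? ?; case: w. Qed.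

Lemma cReD z w : complex.Re (z + w) = complex.Re z + complex.Re w.
Proof. by case: z => ? ?; case: w. Qed.

Lemma cImD z w : complex.Im (z + w) = complex.Im z + complex.Im w.
Proof. by case: z => ? ?; case: w. Qed.

Lemma sqnorm_expi (t : R) : sqnorm (expi t) = 1.
Proof. by rewrite /sqnorm /= cos2Dsin2. Qed.

Lemma expiD (s t : R) : expi (s + t) = expi s * expi t.
Proof.
by rewrite /expi cosD sinD; apply/eqP; rewrite eq_complex /= eqxx andTb addrC.
Qed.

Lemma expi0 : expi 0 = 1 :> R[i].
Proof. by rewrite /expi cos0 sin0. Qed.

End SquaredModulus.

(** * Integrals of squared moduli *)

Section SquareIntegral.
Context d (T : measurableType d) (R : realType).
Implicit Types (mu : {measure set T -> \bar R}) (f g : T -> R[i]).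

Definition measurable_cfun f : Prop :=
  measurable_fun setT (@complex.Re R \o f) /\
  measurable_fun setT (@complex.Im R \o f).

Definition sqint mu f : \bar R := (\int[mu]_x (sqnorm (f x))%:E)%E.

Lemma measurable_cfunD f g : measurable_cfun f -> measurable_cfun g ->
  measurable_cfun (fun x => f x + g x).
Proof.
move=> [f1 f2] [g1 g2]; split.
  rewrite (_ : _ \o _ = (@complex.Re R \o f) \+ (@complex.Re R \o g)).
    exact: measurable_funD.
  by apply/funext => x /=; rewrite cReD.
rewrite (_ : _ \o _ = (@complex.Im R \o f) \+ (@complex.Im R \o g)).
  exact: measurable_funD.
by apply/funext => x /=; rewrite cImD.
Qed.

Lemma measurable_cfunM f g : measurable_cfun f -> measurable_cfun g ->
  measurable_cfun (fun x => f x * g x).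
Proof.
move=> [f1 f2] [g1 g2]; split.
  rewrite (_ : _ \o _ = ((@complex.Re R \o f) \* (@complex.Re R \o g)) \-
     ((@complex.Im R \o f) \* (@complex.Im R \o g))).
    by apply: measurable_funB; exact: measurable_funM.
  by apply/funext => x /=; rewrite cReM.
rewrite (_ : _ \o _ = ((@complex.Re R \o f) \* (@complex.Im R \o g)) \+
     ((@complex.Im R \o f) \* (@complex.Re R \o g))).
  by apply: measurable_funD; exact: measurable_funM.
by apply/funext => x /=; rewrite cImM.
Qed.

Lemma measurable_cfun_cst (c : R[i]) : measurable_cfun (fun=> c).
Proof. by split; exact: measurable_cst. Qed.

Lemma measurable_cfunB f g : measurable_cfun f -> measurable_cfun g ->
  measurable_cfun (fun x => f x - g x).
Proof.
move=> mf mg; rewrite (_ : (fun _ => _) = (fun x => f x + (-1) * g x)).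
  by apply: measurable_cfunD => //; apply: measurable_cfunM => //;
    exact: measurable_cfun_cst.
by apply/funext => x; rewrite mulN1r.
Qed.

Lemma measurable_cfun_sum n (F : nat -> T -> R[i]) :
  (forall j, measurable_cfun (F j)) ->
  measurable_cfun (fun x => \sum_(j < n) F j x).
Proof.
move=> mF; elim: n => [|n IHn].
  rewrite (_ : (fun _ => _) = fun=> 0); first exact: measurable_cfun_cst.
  by apply/funext => x; rewrite big_ord0.
rewrite (_ : (fun _ => _) = fun x => \sum_(j < n) F j x + F n x).
  exact: measurable_cfunD.
by apply/funext => x; rewrite big_ord_recr.
Qed.

Lemma measurable_sqnorm f : measurable_cfun f ->
  measurable_fun setT (fun x => sqnorm (f x)).
Proof.
by move=> [f1 f2]; apply: measurable_funD; exact: measurable_funX.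
Qed.

Lemma measurable_Esqnorm f : measurable_cfun f ->
  measurable_fun setT (fun x => (sqnorm (f x))%:E).
Proof. by move=> mf; apply/measurable_EFinP; exact: measurable_sqnorm. Qed.

Lemma sqint_ge0 mu f : (0 <= sqint mu f)%E.
Proof. by apply: integral_ge0 => x _; rewrite lee_fin sqnorm_ge0. Qed.

Lemma sqintD_le mu f g : measurable_cfun f -> measurable_cfun g ->
  (sqint mu (fun x => (f x + g x)%R) <=
   2%:E * sqint mu f + 2%:E * sqint mu g)%E.
Proof.
move=> mf mg; rewrite /sqint.
have msq h : measurable_cfun h ->
    measurable_fun setT (fun x => 2%:E * (sqnorm (h x))%:E)%E.
  move=> mh; apply/measurable_EFinP; apply: measurable_funM => //.
  exact: measurable_sqnorm.
rewrite -!ge0_integralZl//; try exact: measurable_Esqnorm;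
  try by move=> x _; rewrite lee_fin sqnorm_ge0.
rewrite -ge0_integralD//; try exact: msq;
  try by move=> x _; rewrite lee_fin mulr_ge0// sqnorm_ge0.
apply: ge0_le_integral => //.
- by move=> x _; rewrite lee_fin sqnorm_ge0.
- exact/measurable_Esqnorm/measurable_cfunD.
- by apply: emeasurable_funD; exact: msq.
- by move=> x _; rewrite -!EFinM -EFinD lee_fin sqnormD_le.
Qed.

Lemma sqintB_le mu f g : measurable_cfun f -> measurable_cfun g ->
  (sqint mu (fun x => (f x - g x)%R) <=
   2%:E * sqint mu f + 2%:E * sqint mu g)%E.
Proof.
move=> mf mg; have mNg : measurable_cfun (fun x => - g x).
  have := measurable_cfunB (measurable_cfun_cst 0) mg.
  by under eq_fun do rewrite sub0r.
apply: (le_trans (sqintD_le mu mf mNg)).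
rewrite (_ : sqint mu (fun x => - g x) = sqint mu g)//.
by apply: eq_integral => x _; rewrite sqnormN.
Qed.

Lemma sqintZ mu (c : R[i]) f : measurable_cfun f ->
  sqint mu (fun x => c * f x) = ((sqnorm c)%:E * sqint mu f)%E.
Proof.
move=> mf; rewrite /sqint -ge0_integralZl//.
- by apply: eq_integral => x _; rewrite sqnormM EFinM.
- exact: measurable_Esqnorm.
- by move=> x _; rewrite lee_fin sqnorm_ge0.
- by rewrite lee_fin sqnorm_ge0.
Qed.

Lemma sqint_distC mu f g : sqint mu (fun x => f x - g x) =
  sqint mu (fun x => g x - f x).
Proof. by apply: eq_integral => x _; rewrite sqnorm_distC. Qed.

Lemma ae_eq_sqint mu f g : measurable_cfun f -> measurable_cfun g ->
  {ae mu, forall x, f x = g x} -> sqint mu f = sqint mu g.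
Proof.
move=> mf mg fg; apply: ge0_ae_eq_integral => //.
- exact: measurable_Esqnorm.
- exact: measurable_Esqnorm.
- by move=> x _; rewrite lee_fin sqnorm_ge0.
- by move=> x _; rewrite lee_fin sqnorm_ge0.
- by apply: filterS fg => x /= -> _.
Qed.

(** Cauchy-Schwarz; it is used to compare an average with the limit of its
    terms, where the factor 2 ^ n that iterating [sqintD_le] would give is too
    large. *)
Lemma sqint_sum_le mu n (F : nat -> T -> R[i]) :
  (forall j, measurable_cfun (F j)) ->
  (sqint mu (fun x => (\sum_(j < n) F j x)%R) <=
   n%:R%:E * \sum_(j < n) sqint mu (F j))%E.
Proof.
move=> mF; rewrite /sqint -ge0_integral_sum//=; last 2 first.
- by move=> j; exact: measurable_Esqnorm.
- by move=> j x _; rewrite lee_fin sqnorm_ge0.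
rewrite -ge0_integralZl//=; last 2 first.
- by apply: emeasurable_sum => j; exact: measurable_Esqnorm.
- by move=> x _; apply: sume_ge0 => j _; rewrite lee_fin sqnorm_ge0.
apply: ge0_le_integral => //.
- by move=> x _; rewrite lee_fin sqnorm_ge0.
- exact/measurable_Esqnorm/measurable_cfun_sum.
- apply: emeasurable_funM => //; apply: emeasurable_sum => j.
  exact: measurable_Esqnorm.
- move=> x _; rewrite sumEFin -EFinM lee_fin.
  exact: (@sqnorm_sum_le _ n (F ^~ x)).
Qed.

End SquareIntegral.

(** * The measure of the torus and Parseval's identity *)

Section TorusMeasure.
Context {R : realType}.
Local Notation mu := (@torus_measure R).
Local Notation leb := (@lebesgue_measure R).

Lemma torus_measureT : mu setT = (2 * pi)%:E.
Proof.
rewrite /torus_measure /mrestr setTI lebesgue_measure_itv /= lte_fin.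
rewrite ifT; first by rewrite -EFinB; congr EFin; ring.
by have := pi_gt0 R; lra.
Qed.

Let torus_measure_fin : fin_num_fun mu.
Proof.
move=> A mA; rewrite ge0_fin_numE ?measure_ge0//.
apply: (@le_lt_trans _ _ (mu setT)); first by rewrite le_measure// inE.
by rewrite torus_measureT ltry.
Qed.

HB.instance Definition _ :=
  Measure_isFinite.Build _ _ _ mu torus_measure_fin.

Lemma ae_filter_torus : Filter (almost_everywhere mu).
Proof. exact: ae_filter_ringOfSetsType. Qed.

Lemma ae_torus : {ae mu, forall x : R, - pi <= x <= pi}.
Proof.
exists (~` `[- pi, pi]%classic); split.
- exact: measurableC.
- by rewrite /torus_measure /mrestr setICl measure0.
- by move=> x /= H; contradict H; rewrite in_itv /= in H.
Qed.

Lemma integral_torus (f : R -> \bar R) : measurable_fun setT f ->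
  (\int[mu]_x f x = \int[leb]_(x in `[(- pi)%R, pi]) f x)%E.
Proof.
move=> mf.
transitivity (\int[mu]_(x in `[(- pi)%R, pi]) f x)%E; last first.
  apply: eq_measure_integral.
  move=> A mA AD; change (mu A = leb A).
  by rewrite /torus_measure /mrestr setIidl.
rewrite [RHS]integral_mkcond; apply: ae_eq_integral => //.
  by apply/(measurable_restrictT _ _).1 => //; exact: measurable_funTS.
apply: (@filterS _ _ ae_filter_torus _ _ _ ae_torus) => x Dx _; rewrite patchE.
by rewrite mem_set//= in_itv.
Qed.

Lemma integrable_torus_bounded (f : R -> R) M :
  measurable_fun setT f -> (forall x, - pi <= x <= pi -> `|f x| <= M) ->
  mu.-integrable setT (EFin \o f).
Proof.
move=> mf fM; apply/integrableP; split; first exact/measurable_EFinP.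
apply: (@le_lt_trans _ _ (\int[mu]_x `|M|%:E)%E); last first.
  rewrite integral_cst// [X in (_ * X)%E]torus_measureT.
  by rewrite -EFinM ltry.
apply: ae_ge0_le_integral => //.
- by apply: measurableT_comp => //; exact/measurable_EFinP.
- apply: (@filterS _ _ ae_filter_torus _ _ _ ae_torus) => x Dx _.
  by rewrite lee_fin (le_trans (fM _ Dx))// ler_norm.
Qed.

Lemma continuous_bounded_torus (f : R -> R) : continuous f ->
  exists M, forall x, - pi <= x <= pi -> `|f x| <= M.
Proof.
move=> cf.
have := continuous_compact (continuous_subspaceT cf) (@segment_compact R (- pi) pi).
move=> /compact_bounded[M [_ HM]]; exists (M + 1) => x Dx.
by apply: (HM (M + 1)); [rewrite ltrDl|exists x => //=; rewrite in_itv].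
Qed.

Lemma integrable_torus_continuous (f : R -> R) : continuous f ->
  mu.-integrable setT (EFin \o f).
Proof.
move=> cf; have [M fM] := continuous_bounded_torus cf.
by apply: (integrable_torus_bounded (M := M)) => //; exact: continuous_measurable_fun.
Qed.

Lemma integral_derive1 (a b : R) (F f : R -> R) : a < b -> continuous f ->
  (forall x, is_derive x (1 : R) F (f x)) ->
  (\int[leb]_(x in `[a, b]) (f x)%:E = (F b - F a)%:E)%E.
Proof.
move=> ab cf dF; rewrite EFinB; apply: continuous_FTC2 => //.
- exact: continuous_subspaceT.
- have cF x : {for x, continuous F}.
    by apply/differentiable_continuous/derivable1_diffP; have [] := dF x.
  split.
  + by move=> x _; have [] := dF x.
  + exact/cvg_at_right_filter/cF.
  + exact/cvg_at_left_filter/cF.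
- by move=> x _; rewrite derive1E derive_val.
Qed.

Lemma sin_int_pi (m : int) : sin (m%:~R * pi) = 0 :> R.
Proof.
have H (n : nat) : sin (n%:R * pi) = 0 :> R.
  elim: n => [|n IHn]; first by rewrite mul0r sin0.
  by rewrite -natr1 mulrDl mul1r sinD IHn sinpi mulr0 mul0r addr0.
case: m => n; first exact: H.
by rewrite NegzE intrN mulNr sinN (H n.+1) oppr0.
Qed.

Lemma is_derive_sinM (m x : R) :
  is_derive x (1 : R) (fun x => sin (m * x)) (cos (m * x) * m).
Proof.
apply: (@is_derive1_comp _ sin (fun x => m * x)).
by rewrite -[X in is_derive _ _ _ X](mulr1 m); exact: is_deriveZ.
Qed.

Lemma is_derive_cosM (m x : R) :
  is_derive x (1 : R) (fun x => cos (m * x)) (- sin (m * x) * m).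
Proof.
apply: (@is_derive1_comp _ cos (fun x => m * x)).
by rewrite -[X in is_derive _ _ _ X](mulr1 m); exact: is_deriveZ.
Qed.

Lemma continuous_cosM (m : R) : continuous (fun x => cos (m * x) : R).
Proof.
move=> x; apply/differentiable_continuous/derivable1_diffP.
by have [] := is_derive_cosM m x.
Qed.

Lemma continuous_sinM (m : R) : continuous (fun x => sin (m * x) : R).
Proof.
move=> x; apply/differentiable_continuous/derivable1_diffP.
by have [] := is_derive_sinM m x.
Qed.

Lemma integral_cos_freq (m : int) :
  (\int[mu]_x (cos (m%:~R * x))%:E = (if m == 0 then 2 * pi else 0)%:E)%E.
Proof.
have [->|m0] := eqVneq m 0.
  under eq_integral do rewrite mul0r cos0.
  by rewrite integral_cst// [X in (_ * X)%E]torus_measureT mul1e.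
rewrite integral_torus; last first.
  by apply/measurable_EFinP; apply: continuous_measurable_fun; exact: continuous_cosM.
have m0' : (m%:~R : R) != 0 by rewrite intr_eq0.
have dF x : is_derive x (1 : R) (fun x => m%:~R^-1 * sin (m%:~R * x))
    (cos (m%:~R * x)).
  rewrite (_ : cos _ = m%:~R^-1 * (cos (m%:~R * x) * m%:~R)).
    by apply: is_deriveZ; exact: is_derive_sinM.
  by rewrite mulrCA mulVf// mulr1.
rewrite (integral_derive1 _ (@continuous_cosM _) dF).
  by rewrite mulrN sinN sin_int_pi oppr0 mulr0 subrr.
by have := pi_gt0 R; lra.
Qed.

Lemma integral_sin_freq (m : int) :
  (\int[mu]_x (sin (m%:~R * x))%:E = 0)%E.
Proof.
have [->|m0] := eqVneq m 0.
  under eq_integral do rewrite mul0r sin0.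
  by rewrite integral0.
rewrite integral_torus; last first.
  by apply/measurable_EFinP; apply: continuous_measurable_fun; exact: continuous_sinM.
have m0' : (m%:~R : R) != 0 by rewrite intr_eq0.
have dF x : is_derive x (1 : R) (fun x => - m%:~R^-1 * cos (m%:~R * x))
    (sin (m%:~R * x)).
  rewrite (_ : sin _ = - m%:~R^-1 * (- sin (m%:~R * x) * m%:~R)).
    by apply: is_deriveZ; exact: is_derive_cosM.
  by rewrite mulrA mulrNN mulrAC mulVf// mul1r.
rewrite (integral_derive1 _ (@continuous_sinM _) dF).
  by rewrite mulrN cosN subrr.
by have := pi_gt0 R; lra.
Qed.

(** Orthogonality of the characters, in the real form in which the expansion of
    a squared modulus produces it. *)
Lemma integral_cos_sin_freq (a b : R) (m : int) :
  (\int[mu]_x (a * cos (m%:~R * x) + b * sin (m%:~R * x))%:E =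
   (if m == 0 then 2 * pi * a else 0)%:E)%E.
Proof.
have ic : mu.-integrable setT (fun x => (cos (m%:~R * x))%:E).
  exact/integrable_torus_continuous/continuous_cosM.
have is_ : mu.-integrable setT (fun x => (sin (m%:~R * x))%:E).
  exact/integrable_torus_continuous/continuous_sinM.
transitivity (\int[mu]_x (a%:E * (cos (m%:~R * x))%:E +
    b%:E * (sin (m%:~R * x))%:E))%E.
  by apply: eq_integral.
rewrite integralD//; try exact: integrableZl.
rewrite !integralZl// integral_cos_freq integral_sin_freq mule0 adde0.
by rewrite -EFinM; case: ifPn => _; rewrite ?mulr0// mulrC.
Qed.

Lemma sqnorm_sum n (F : nat -> R[i]) : sqnorm (\sum_(j < n) F j) =
  \sum_(j < n) \sum_(l < n)
   (complex.Re (F j) * complex.Re (F l) + complex.Im (F j) * complex.Im (F l)).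
Proof.
rewrite /sqnorm cRe_sum cIm_sum !expr2 !big_distrl /= -big_split /=.
apply: eq_bigr => j _; rewrite !big_distrr /= -big_split /=.
by [].
Qed.

(** The frequencies are given by an arbitrary injection, since the identity is
    applied to the enumeration of all of them, to a subsequence of it, and to
    0, -1, -2, ... for the Fejer kernel. *)
Lemma parseval_sum n (q : nat -> int) (c : nat -> R[i]) : injective q ->
  sqint mu (fun x => \sum_(j < n) c j * expi (x * (q j)%:~R)) =
  (2 * pi * \sum_(j < n) sqnorm (c j))%:E.
Proof.
move=> qI.
pose A j l := complex.Re (c j) * complex.Re (c l) +
              complex.Im (c j) * complex.Im (c l).
pose B j l := complex.Re (c j) * complex.Im (c l) -
              complex.Im (c j) * complex.Re (c l).
have E x : sqnorm (\sum_(j < n) c j * expi (x * (q j)%:~R)) =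
    \sum_(p : 'I_n * 'I_n) (A p.1 p.2 * cos ((q p.1 - q p.2)%:~R * x) +
                      B p.1 p.2 * sin ((q p.1 - q p.2)%:~R * x)).
  rewrite (sqnorm_sum n (fun j => c j * expi (x * (q j)%:~R))) pair_big /=.
  apply: eq_bigr => -[j l] _ /=.
  rewrite intrB mulrBl sinB cosB !cReM !cImM /= ![_%:~R * x]mulrC /A /B; ring.
rewrite /sqint; under eq_integral do rewrite E -sumEFin.
rewrite integral_sum//=; last first.
  move=> p; apply: integrable_torus_continuous => x.
  by apply: cvgD; apply: cvgM; [exact: cvg_cst|exact: continuous_cosM|
     exact: cvg_cst|exact: continuous_sinM].
under eq_bigr do rewrite integral_cos_sin_freq.
rewrite sumEFin; congr EFin.
transitivity (\sum_(p : 'I_n * 'I_n) if p.1 == p.2 then 2 * pi * A p.1 p.2 else 0).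
  apply: eq_bigr => p _; rewrite subr_eq0 (inj_eq qI).
  by [].
rewrite -(pair_big xpredT xpredT (fun j l : 'I_n => if j == l then 2 * pi * A j l else 0)) /=.
rewrite mulr_sumr; apply: eq_bigr => j _.
rewrite -big_mkcond /= (big_pred1 j) => [|l]; last by rewrite eq_sym.
by rewrite /A /sqnorm !expr2.
Qed.

Lemma inL2P (f : R -> R[i]) :
  inL2 f <-> measurable_cfun f /\ (sqint mu f < +oo)%E.
Proof.
have H (g : R -> R) : g \in Lfun mu 2%:E <->
    measurable_fun setT g /\ (\int[mu]_x (g x ^+ 2)%:E < +oo)%E.
  split => [gL|[mg gfin]].
    have := Lfun2_integrable_sqr gL => /integrableP[_ gi].
    split; first by move/andP : gL => [/set_mem].
    apply: le_lt_trans gi; apply: ge0_le_integral => //.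
    - by move=> x _; rewrite lee_fin sqr_ge0.
    - apply/measurable_EFinP/measurable_funX.
      by move/andP : gL => [/set_mem].
    - do 2 apply: measurableT_comp => //.
      by apply: measurable_funX; move/andP : gL => [/set_mem].
    - by move=> x _; rewrite /= lee_fin ler_norm.
  apply/andP; split; apply: mem_set => //=.
  rewrite /finite_norm unlock /Lnorm; apply: poweR_lty.
  apply: le_lt_trans gfin; rewrite le_eqVlt; apply/orP; left; apply/eqP.
  apply: eq_integral => x _; rewrite /= -[in RHS](real_normK (num_real (g x))).
  by rewrite powR_mulrn.
have sp (f1 f2 : R -> R) : measurable_fun setT f1 -> measurable_fun setT f2 ->
   (\int[mu]_x (f1 x ^+ 2 + f2 x ^+ 2)%:E = \int[mu]_x (f1 x ^+ 2)%:E
     + \int[mu]_x (f2 x ^+ 2)%:E)%E.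
  move=> m1 m2; under eq_integral do rewrite EFinD.
  apply: ge0_integralD => //.
  - by move=> x _; rewrite lee_fin sqr_ge0.
  - exact/measurable_EFinP/measurable_funX.
  - by move=> x _; rewrite lee_fin sqr_ge0.
  - exact/measurable_EFinP/measurable_funX.
split.
  move=> [/H[m1 i1] /H[m2 i2]]; split; first by split.
  by rewrite /sqint /sqnorm sp// lte_add_pinfty.
move=> [[m1 m2]]; rewrite /sqint /sqnorm sp// => h.
have ge0 (g : R -> R) : (0 <= \int[mu]_x (g x ^+ 2)%:E)%E.
  by apply: integral_ge0 => x _; rewrite lee_fin sqr_ge0.
split; apply/H; split => //; apply: le_lt_trans h.
  by rewrite leeDl.
by rewrite leeDr.
Qed.

Lemma normL2E (f : R -> R[i]) : normL2 f = (sqint mu f `^ 2^-1)%E.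
Proof.
rewrite /normL2 unlock /Lnorm; congr (_ `^ _)%E; apply: eq_integral => x _.
rewrite abse_EFin poweR_EFin ger0_norm; last first.
  by case: (f x) => a b; exact: sqrtr_ge0.
by rewrite powR_mulrn ?sqr_normc//; case: (f x) => a b; exact: sqrtr_ge0.
Qed.

End TorusMeasure.

(** * Characters and their images *)

Section Modes.
Context {R : realType}.
Local Notation mu := (@torus_measure R).
Local Notation leb := (@lebesgue_measure R).

(** The enumeration 0, -1, 1, -2, 2, ... of the integers: sums over finitely many
    frequencies become sums over an initial segment of nat. *)
Definition freq (j : nat) : int := if odd j then Negz j./2 else Posz j./2.

Lemma freq_inj : injective freq.
Proof.
move=> i j; rewrite /freq.
have := odd_double_half i; have := odd_double_half j.
by case: (odd i); case: (odd j) => /= Ei Ej // -[] e; rewrite -Ei -Ej e.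
Qed.

Lemma freq_large N j : (N.*2 <= j)%N -> (N <= absz (freq j))%N.
Proof.
rewrite /freq => Nj; have := odd_double_half j.
case: (odd j) => /= e; last by rewrite -leq_double (leq_trans Nj)// -{1}e.
by rewrite -leq_double (leq_trans Nj)// -{1}e doubleS !addSn ltnW// addnC.
Qed.

Lemma freq_le j : (absz (freq j) <= j)%N.
Proof.
rewrite /freq; have := odd_double_half j.
by case: (odd j) => /= e; rewrite -[X in (_ <= X)%N]e -addnn; lia.
Qed.

Lemma freq_surj (k : int) : exists j, freq j = k.
Proof.
case: k => n; [exists n.*2|exists n.*2.+1]; rewrite /freq /= odd_double.
  by rewrite doubleK.
by rewrite /= uphalf_double.
Qed.

Definition mode (j : nat) (x : R) : R[i] := expi (x * (freq j)%:~R).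

Definition ccontinuous (f : R -> R[i]) : Prop :=
  continuous (@complex.Re R \o f) /\ continuous (@complex.Im R \o f).

Lemma ccontinuous_measurable f : ccontinuous f -> measurable_cfun f.
Proof. by move=> [? ?]; split; apply: continuous_measurable_fun. Qed.

Lemma ccontinuous_expi (m : R) : ccontinuous (fun x => expi (x * m)).
Proof.
split; rewrite /comp /=.
  under eq_fun do rewrite mulrC; exact: continuous_cosM.
under eq_fun do rewrite mulrC; exact: continuous_sinM.
Qed.

Lemma ccontinuousM f g : ccontinuous f -> ccontinuous g ->
  ccontinuous (fun x => f x * g x).
Proof.
move=> [f1 f2] [g1 g2]; split; rewrite /comp => x.
  under eq_fun do rewrite cReM.
  by apply: cvgB; apply: cvgM; [exact: f1|exact: g1|exact: f2|exact: g2].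
under eq_fun do rewrite cImM.
by apply: cvgD; apply: cvgM; [exact: f1|exact: g2|exact: f2|exact: g1].
Qed.

Lemma ccontinuous_cst (c : R[i]) : ccontinuous (fun=> c).
Proof. by split => x; exact: cvg_cst. Qed.

Lemma ccontinuousD f g : ccontinuous f -> ccontinuous g ->
  ccontinuous (fun x => f x + g x).
Proof.
move=> [f1 f2] [g1 g2]; split; rewrite /comp => x.
  by under eq_fun do rewrite cReD; apply: cvgD; [exact: f1|exact: g1].
by under eq_fun do rewrite cImD; apply: cvgD; [exact: f2|exact: g2].
Qed.

Lemma ccontinuous_sum n (F : nat -> R -> R[i]) :
  (forall j, ccontinuous (F j)) -> ccontinuous (fun x => \sum_(j < n) F j x).
Proof.
move=> cF; elim: n => [|n IHn].
  by under eq_fun do rewrite big_ord0; exact: ccontinuous_cst.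
by under eq_fun do rewrite big_ord_recr; exact: ccontinuousD.
Qed.

Lemma inL2_ccontinuous f : ccontinuous f -> inL2 f.
Proof.
move=> cf; apply/inL2P; split; first exact: ccontinuous_measurable.
have /integrableP[_] : mu.-integrable setT (EFin \o (fun x => sqnorm (f x))).
  apply: integrable_torus_continuous => x; case: cf => f1 f2.
  by apply: cvgD; [under eq_fun do rewrite expr2|under eq_fun do rewrite expr2];
    (apply: cvgM; [exact: f1|exact: f1]) || (apply: cvgM; [exact: f2|exact: f2]).
by apply: le_lt_trans; rewrite le_eqVlt; apply/orP; left; apply/eqP;
  apply: eq_integral => x _; rewrite /= ger0_norm// sqnorm_ge0.
Qed.

(** Differentiation preserves the span of cos (m x) and sin (m x), so that
    smoothness of the characters follows by induction. *)
Lemma derive1n_cos_sin (m a b : R) n : exists a' b' : R,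
  derive1n n (fun x => a * cos (m * x) + b * sin (m * x)) =
  (fun x => a' * cos (m * x) + b' * sin (m * x)).
Proof.
elim: n => [|n [a' [b' E]]]; first by exists a, b.
exists (b' * m), (- a' * m); rewrite derive1nS E; apply/funext => x.
rewrite derive1E.
have -> : (fun x => a' * cos (m * x) + b' * sin (m * x)) =
  (a' \*: (fun x => cos (m * x))) \+ (b' \*: (fun x => sin (m * x))) by [].
have d1 := is_deriveZ a' (is_derive_cosM m x).
have d2 := is_deriveZ b' (is_derive_sinM m x).
have d3 := is_deriveD d1 d2.
rewrite (@derive_val _ _ _ _ _ _ _ d3) /GRing.scale /=; ring.
Qed.

Lemma derivable_cos_sin (m a b x : R) :
  derivable (fun x => a * cos (m * x) + b * sin (m * x)) x 1.
Proof.
have d1 := is_deriveZ a (is_derive_cosM m x).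
have d2 := is_deriveZ b (is_derive_sinM m x).
by have [] := is_deriveD d1 d2.
Qed.

Lemma expi_intM2pi (k : int) : expi (2 * pi * k%:~R) = 1 :> R[i].
Proof.
have H (n : nat) : expi (2 * pi * n%:R) = 1 :> R[i].
  elim: n => [|n IHn]; first by rewrite mulr0 expi0.
  rewrite -[n.+1%:R]natr1 mulrDr mulr1 expiD IHn mul1r /expi.
  by rewrite mulr_natl cos2pi sin2pi.
case: k => n; first exact: H.
rewrite NegzE intrN mulrN.
have := @expiD R (2 * pi * n.+1%:R) (- (2 * pi * n.+1%:R)).
by rewrite subrr expi0 (H n.+1) mul1r.
Qed.

Lemma smooth_torus_expi (k : int) :
  smooth_torus (fun x : R => expi (x * k%:~R)).
Proof.
split; first by move=> x; rewrite mulrDl expiD expi_intM2pi mulr1.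
move=> n x.
have -> : @complex.Re R \o (fun x : R => expi (x * k%:~R)) =
    (fun x => 1 * cos (k%:~R * x) + 0 * sin (k%:~R * x)).
  by apply/funext => y; rewrite /= mul1r mul0r addr0 mulrC.
have -> : @complex.Im R \o (fun x : R => expi (x * k%:~R)) =
    (fun x => 0 * cos (k%:~R * x) + 1 * sin (k%:~R * x)).
  by apply/funext => y; rewrite /= mul1r mul0r add0r mulrC.
have [a [b ->]] := derive1n_cos_sin k%:~R 1 0 n.
have [a' [b' ->]] := derive1n_cos_sin k%:~R 0 1 n.
by split; exact: derivable_cos_sin.
Qed.

Lemma torus_integral_expi (w : R[i]) (m : int) :
  torus_integral (fun y => w * expi (y * m%:~R)) =
  if m == 0 then (2 * pi)%:C * w else 0.
Proof.
have E a b : Rintegral leb `[- pi, pi]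
    (fun y => a * cos (m%:~R * y) + b * sin (m%:~R * y)) =
    if m == 0 then 2 * pi * a else 0.
  rewrite /Rintegral -integral_torus.
    by rewrite integral_cos_sin_freq.
  apply/measurable_EFinP; apply: continuous_measurable_fun => x.
  by apply: cvgD; apply: cvgM; [exact: cvg_cst|exact: continuous_cosM|
     exact: cvg_cst|exact: continuous_sinM].
rewrite /torus_integral; case: w => a b.
have -> : @complex.Re R \o (fun y => (a +i* b) * expi (y * m%:~R)) =
    fun y => a * cos (m%:~R * y) + (- b) * sin (m%:~R * y).
  by apply/funext => y; rewrite /= mulNr ![m%:~R * _]mulrC.
have -> : @complex.Im R \o (fun y => (a +i* b) * expi (y * m%:~R)) =
    fun y => b * cos (m%:~R * y) + a * sin (m%:~R * y).
  by apply/funext => y; rewrite /= addrC ![m%:~R * _]mulrC.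
rewrite !E; case: ifPn => // _.
by apply/eqP; rewrite eq_complex /= !mul0r subr0 addr0 !eqxx.
Qed.

Lemma clim_near_cst (u : nat -> R[i]) (c : R[i]) N :
  (forall n, (N <= n)%N -> u n = c) -> clim u = c.
Proof.
move=> uc; rewrite /clim.
have -> : lim ((@complex.Re R \o u) @ \oo) = complex.Re c.
  apply/cvg_lim => //; apply: cvg_near_cst; exists N => // n /= Nn.
  by rewrite uc.
have -> : lim ((@complex.Im R \o u) @ \oo) = complex.Im c.
  apply/cvg_lim => //; apply: cvg_near_cst; exists N => // n /= Nn.
  by rewrite uc.
by case: c uc.
Qed.

(** By orthogonality a single term of the series over the frequencies is
    nonzero, so the symmetric partial sums are eventually constant. *)
Lemma pseudo_diff_expi (sigma : R -> int -> R[i]) (k : int) x :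
  pseudo_diff sigma (fun y => expi (y * k%:~R)) x =
  sigma x k * expi (x * k%:~R).
Proof.
rewrite /pseudo_diff /sum_int.
pose w := sigma x k * expi (x * k%:~R).
have E m : torus_integral (fun y =>
     expi ((x - y) * m%:~R) * sigma x m * expi (y * k%:~R)) =
    if m == k then (2 * pi)%:C * w else 0.
  have -> : (fun y => expi ((x - y) * m%:~R) * sigma x m * expi (y * k%:~R)) =
      fun y => (sigma x m * expi (x * m%:~R)) * expi (y * (k - m)%:~R).
    apply/funext => y; rewrite [_ * sigma x m]mulrC -!mulrA -!expiD.
    by congr (_ * expi _); rewrite intrB; ring.
  rewrite torus_integral_expi subr_eq0 eq_sym.
  by case: eqP => // ->.
rewrite (@clim_near_cst _ ((2 * pi)%:C * w) (absz k)); last first.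
  move=> n kn.
  have kn' : (absz (k + n%:Z)%R < n.*2.+1)%N by lia.
  rewrite (bigD1 (Ordinal kn')) //= big1 ?addr0.
    by rewrite E ifT//; lia.
  move=> j /eqP jk; rewrite E ifF//; apply/negbTE/eqP => e.
  by apply: jk; apply: val_inj => /=; lia.
rewrite mulrA; have -> : ((2 * pi)^-1)%:C * (2 * pi)%:C = 1 :> R[i].
  by rewrite -rmorphM /= mulVf// mulf_neq0// ?gt_eqF// pi_gt0.
by rewrite mul1r.
Qed.

End Modes.

(** * The Sobolev inequality and sums of modulated characters *)

Section Sobolev.
Context {R : realType}.
Local Notation mu := (@torus_measure R).
Local Notation leb := (@lebesgue_measure R).

Definition is_cderive (f f' : R -> R[i]) : Prop := forall x,
  is_derive x (1 : R) (@complex.Re R \o f) (complex.Re (f' x)) /\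
  is_derive x (1 : R) (@complex.Im R \o f) (complex.Im (f' x)).

Lemma is_cderive_continuous f f' : is_cderive f f' -> ccontinuous f.
Proof.
move=> df; split => x; apply/differentiable_continuous/derivable1_diffP;
  by have [[? _] [? _]] := df x.
Qed.

Lemma continuous_sqnorm (f : R -> R[i]) : ccontinuous f ->
  continuous (fun x => sqnorm (f x)).
Proof.
move=> [f1 f2] x; apply: cvgD; under eq_fun do rewrite expr2.
  by apply: cvgM; exact: f1.
by apply: cvgM; exact: f2.
Qed.

(** The derivative of |f|^2 is bounded by 2 |f| |f'|, hence by
    |f|^2 / h + h |f'|^2; integrate between a and b. *)
Lemma sqnorm_osc (f f' : R -> R[i]) (h a b : R) :
  is_cderive f f' -> ccontinuous f' -> 0 < h ->
  - pi <= a -> a < b -> b <= pi ->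
  (`|sqnorm (f b) - sqnorm (f a)|%:E <=
   \int[mu]_x (h^-1 * sqnorm (f x) + h * sqnorm (f' x))%:E)%E.
Proof.
move=> df cf' h0 aD ab bD; have cf := is_cderive_continuous df.
pose g' x := 2 * (complex.Re (f x) * complex.Re (f' x) +
                  complex.Im (f x) * complex.Im (f' x)).
have dg x : is_derive x (1 : R) (fun x => sqnorm (f x)) (g' x).
  have [d1 d2] := df x.
  have := is_deriveD (is_deriveM d1 d1) (is_deriveM d2 d2).
  rewrite (_ : (_ + _ : R -> R) = fun x => sqnorm (f x)); last first.
    by apply/funext => y; rewrite /sqnorm !expr2.
  by rewrite /GRing.scale /= /g'; congr is_derive; ring.
have cg' : continuous g'.
  move=> x; case: cf cf' => f1 f2 [f1' f2'].
  apply: cvgM; first exact: cvg_cst.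
  by apply: cvgD; apply: cvgM; [exact: f1|exact: f1'|exact: f2|exact: f2'].
pose p x := h^-1 * sqnorm (f x) + h * sqnorm (f' x).
have cp : continuous p.
  move=> x; apply: cvgD; apply: cvgM; try exact: cvg_cst.
    exact: continuous_sqnorm.
  exact: continuous_sqnorm.
have p_ge0 x : 0 <= p x.
  by rewrite addr_ge0// mulr_ge0 ?sqnorm_ge0 ?invr_ge0 ?ltW.
have g'p x : `|g' x| <= p x.
  rewrite /g' /p /sqnorm; case: (f x) => u v; case: (f' x) => u' v' /=.
  rewrite ler_norml -subr_ge0 -[X in _ && X]subr_ge0; apply/andP; split.
    have -> : 2 * (u * u' + v * v') - - (h^-1 * (u ^+ 2 + v ^+ 2) +
        h * (u' ^+ 2 + v' ^+ 2)) =
        h^-1 * ((u + h * u') ^+ 2 + (v + h * v') ^+ 2).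
      by field; rewrite gt_eqF.
    by rewrite mulr_ge0 ?invr_ge0 ?(ltW h0)// addr_ge0 ?sqr_ge0.
  have -> : h^-1 * (u ^+ 2 + v ^+ 2) + h * (u' ^+ 2 + v' ^+ 2) -
      2 * (u * u' + v * v') = h^-1 * ((u - h * u') ^+ 2 + (v - h * v') ^+ 2).
    by field; rewrite gt_eqF.
  by rewrite mulr_ge0 ?invr_ge0 ?(ltW h0)// addr_ge0 ?sqr_ge0.
have mg' (D : set R) : measurable_fun D (fun x => (g' x)%:E).
  by apply/measurable_EFinP/measurable_funTS; apply: continuous_measurable_fun.
have mp (D : set R) : measurable_fun D (fun x => (p x)%:E).
  by apply/measurable_EFinP/measurable_funTS; apply: continuous_measurable_fun.
rewrite -[leLHS]abse_EFin -(integral_derive1 ab cg' dg).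
apply: (@le_trans _ _ (\int[leb]_(x in `[a, b]) `|(g' x)%:E|)%E).
  by apply: le_abse_integral => //; exact: mg'.
apply: (@le_trans _ _ (\int[leb]_(x in `[a, b]) (p x)%:E)%E).
  apply: ge0_le_integral => //.
    by apply: measurableT_comp => //; exact: mg'.
    exact: mp.
  by move=> x _; rewrite lee_fin g'p.
rewrite integral_torus; last exact: mp.
apply: ge0_subset_integral => //.
- exact: mp.
- by move=> x _; rewrite lee_fin.
- by move=> x; rewrite /= !in_itv /= => /andP[ax xb]; apply/andP; split; lra.
Qed.

(** By [sqnorm_osc], |f(x)|^2 exceeds |f(y)|^2 by at most
    int (|f|^2 / h + h |f'|^2), for every y; integrate in y.  Taking h small
    makes the contribution of f' as small as desired, at the price of a large
    factor in front of int |f|^2. *)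
Lemma sobolev_torus (f f' : R -> R[i]) (h x : R) :
  is_cderive f f' -> ccontinuous f' -> 0 < h -> - pi <= x <= pi ->
  ((2 * pi * sqnorm (f x))%:E <= (1 + 2 * pi / h)%:E * sqint mu f +
     (2 * pi * h)%:E * sqint mu f')%E.
Proof.
move=> df cf' h0 /andP[x1 x2]; have cf := is_cderive_continuous df.
have mf := ccontinuous_measurable cf; have mf' := ccontinuous_measurable cf'.
have pi0 := pi_gt0 R.
set J := (\int[mu]_x (h^-1 * sqnorm (f x) + h * sqnorm (f' x))%:E)%E.
have JE : J = (h^-1%:E * sqint mu f + h%:E * sqint mu f')%E.
  transitivity (\int[mu]_x (h^-1%:E * (sqnorm (f x))%:E +
      h%:E * (sqnorm (f' x))%:E))%E; first by apply: eq_integral.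
  rewrite /sqint.
  have ms (k : R) g : measurable_cfun g ->
      measurable_fun setT (fun x => k%:E * (sqnorm (g x))%:E)%E.
    by move=> mg; apply/measurable_EFinP/measurable_funM => //; exact: measurable_sqnorm.
  rewrite ge0_integralD//.
  - rewrite !ge0_integralZl//; try exact: measurable_Esqnorm;
      by [move=> y _; rewrite lee_fin sqnorm_ge0 | rewrite lee_fin ?invr_ge0 ltW].
  - by move=> y _; rewrite -EFinM lee_fin mulr_ge0 ?sqnorm_ge0// invr_ge0 ltW.
  - exact: ms.
  - by move=> y _; rewrite -EFinM lee_fin mulr_ge0 ?sqnorm_ge0// ltW.
  - exact: ms.
have J0 : (0 <= J)%E.
  apply: integral_ge0 => y _; rewrite lee_fin.
  by rewrite addr_ge0// mulr_ge0 ?sqnorm_ge0 ?invr_ge0 ?ltW.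
have H y : - pi <= y <= pi -> ((sqnorm (f x))%:E <= (sqnorm (f y))%:E + J)%E.
  move=> /andP[y1 y2]; rewrite -leeBlDl//.
  have [xy|yx|->] := ltgtP x y.
  - apply: le_trans (sqnorm_osc df cf' h0 x1 xy y2).
    by rewrite -EFinB lee_fin distrC ler_norm.
  - apply: le_trans (sqnorm_osc df cf' h0 y1 yx x2).
    by rewrite -EFinB lee_fin ler_norm.
  - by rewrite -EFinB subrr.
clearbody J.
have : (\int[mu]_y (sqnorm (f x))%:E <= \int[mu]_y ((sqnorm (f y))%:E + J))%E.
  apply: ae_ge0_le_integral => //.
  - by move=> y _; rewrite lee_fin sqnorm_ge0.
  - by move=> y _; rewrite adde_ge0// lee_fin sqnorm_ge0.
  - by apply: emeasurable_funD => //; exact: measurable_Esqnorm.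
  - by apply: (@filterS _ _ ae_filter_torus _ _ _ ae_torus) => y /H.
rewrite integral_cst// [X in (_ * X)%E]torus_measureT -EFinM mulrC.
move=> /le_trans; apply; rewrite ge0_integralD//; last 2 first.
- by move=> y _; rewrite lee_fin sqnorm_ge0.
- exact: measurable_Esqnorm.
rewrite integral_cst// [X in (_ * X)%E]torus_measureT -/(sqint mu f) JE.
have hV0 : 0 <= h^-1 by rewrite invr_ge0 ltW.
have pih : 0 <= 2 * pi / h by rewrite mulr_ge0//; lra.
have := sqint_ge0 mu f'; have := sqint_ge0 mu f.
move: (sqint mu f) (sqint mu f') => a b a0 b0.
have ha0 : (0 <= h^-1%:E * a)%E by rewrite mule_ge0.
have hb0 : (0 <= h%:E * b)%E by rewrite mule_ge0// lee_fin ltW.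
have -> : ((1 + 2 * pi / h)%:E * a = a + (2 * pi / h)%:E * a)%E.
  by rewrite EFinD ge0_muleDl ?lee_fin// mul1e.
rewrite -addeA leeD2l// ge0_muleDl// !(muleAC _ _ (2 * pi)%:E) -!EFinM.
by rewrite [h^-1 * _]mulrC [h * _]mulrC.
Qed.

Lemma is_cderiveM_cst (f f' : R -> R[i]) (a w : R[i]) :
  is_cderive f f' -> is_cderive (fun y => a * (f y * w)) (fun y => a * (f' y * w)).
Proof.
move=> df x; have [d1 d2] := df x.
have E (g : R -> R[i]) y : a * (g y * w) = (a * w) * g y by rewrite mulrCA mulrC.
rewrite !E; move: (a * w) E => c E; split.
  rewrite cReM (_ : _ \o _ = (complex.Re c \*: (@complex.Re R \o f)) -
      (complex.Im c \*: (@complex.Im R \o f))).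
    exact: is_deriveB (is_deriveZ _ d1) (is_deriveZ _ d2).
  by apply/funext => y; rewrite /= E cReM.
rewrite cImM (_ : _ \o _ = (complex.Re c \*: (@complex.Im R \o f)) +
    (complex.Im c \*: (@complex.Re R \o f))).
  exact: is_deriveD (is_deriveZ _ d2) (is_deriveZ _ d1).
by apply/funext => y; rewrite /= E cImM.
Qed.

Lemma is_cderive_sum n (f f' : nat -> R -> R[i]) :
  (forall j, is_cderive (f j) (f' j)) ->
  is_cderive (fun y => \sum_(j < n) f j y) (fun y => \sum_(j < n) f' j y).
Proof.
move=> df x; split.
  rewrite /= (cRe_sum n (fun j => f' j x)) (_ : _ \o _ = \sum_(j < n) (@complex.Re R \o f j)).
    by apply: is_derive_sum => j; have [] := df j x.
  by apply/funext => y; rewrite /= (cRe_sum n (fun j => f j y)) fct_sumE.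
rewrite /= (cIm_sum n (fun j => f' j x)) (_ : _ \o _ = \sum_(j < n) (@complex.Im R \o f j)).
  by apply: is_derive_sum => j; have [] := df j x.
by apply/funext => y; rewrite /= (cIm_sum n (fun j => f j y)) fct_sumE.
Qed.

(** Fix x and apply the Sobolev inequality to
    F(x, y) = sum_j c_j s_j(y) e_j(x) as a function of y, at the point y = x.  In
    the double integrals of |F|^2 and of |dF/dy|^2 the order of integration may
    be exchanged, and for fixed y the integral in x is given by Parseval.  The
    bound A is needed only where the coefficient does not vanish, so it can be
    small for sums over high frequencies. *)
Lemma symbol_sum_bound n (c : nat -> R[i]) (s s' : nat -> R -> R[i])
    (h A C : R) : 0 < h -> 0 <= A -> 0 <= C ->
  (forall j, is_cderive (s j) (s' j)) -> (forall j, ccontinuous (s' j)) ->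
  (forall j x, c j != 0 -> - pi <= x <= pi -> sqnorm (s j x) <= A) ->
  (forall j x, - pi <= x <= pi -> sqnorm (s' j x) <= C) ->
  (sqint mu (fun x => (\sum_(j < n) c j * (s j x * mode j x))%R) <=
    (2 * pi * ((1 + 2 * pi / h) * A + 2 * pi * h * C) *
     \sum_(j < n) sqnorm (c j))%:E)%E.
Proof.
move=> h0 A0 C0 ds cs' sA sC; have pi0 := pi_gt0 R.
set S := \sum_(j < n) sqnorm (c j).
pose F (t : nat -> R -> R[i]) (x y : R) := \sum_(j < n) c j * (t j y * mode j x).
have cs j : ccontinuous (s j) by exact: is_cderive_continuous (ds j).
have mmode j : measurable_cfun (mode (R := R) j).
  exact/ccontinuous_measurable/ccontinuous_expi.
have mF (t : nat -> R -> R[i]) : (forall j, ccontinuous (t j)) ->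
    measurable_fun setT (fun z : R * R => (sqnorm (F t z.1 z.2))%:E).
  move=> ct; apply: measurable_Esqnorm.
  apply: (@measurable_cfun_sum _ _ _ n (fun j z => c j * (t j z.2 * mode j z.1))).
  move=> j; apply: measurable_cfunM; first exact: measurable_cfun_cst.
  have [m1 m2] := ccontinuous_measurable (ct j).
  have [m3 m4] := mmode j.
  apply: measurable_cfunM; split.
  - exact: measurableT_comp m1 measurable_snd.
  - exact: measurableT_comp m2 measurable_snd.
  - exact: measurableT_comp m3 measurable_fst.
  - exact: measurableT_comp m4 measurable_fst.
have bF (t : nat -> R -> R[i]) (B : R) : 0 <= B -> (forall j, ccontinuous (t j)) ->
    (forall j x, c j != 0 -> - pi <= x <= pi -> sqnorm (t j x) <= B) ->
    (\int[mu]_x \int[mu]_y (sqnorm (F t x y))%:E <= ((2 * pi) ^+ 2 * B * S)%:E)%E.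
  move=> B0 ct tB.
  have -> : (\int[mu]_x \int[mu]_y (sqnorm (F t x y))%:E =
      \int[mu]_y \int[mu]_x (sqnorm (F t x y))%:E)%E.
    apply: (@fubini_tonelli _ _ _ _ _ mu mu
      (fun z : R * R => (sqnorm (F t z.1 z.2))%:E)); first exact: mF.
    by move=> z; rewrite lee_fin sqnorm_ge0.
  have E y : (\int[mu]_x (sqnorm (F t x y))%:E =
      (2 * pi * \sum_(j < n) sqnorm (c j) * sqnorm (t j y))%:E)%E.
    under eq_bigr do rewrite -sqnormM.
    rewrite -(parseval_sum n (fun j => c j * t j y) freq_inj); apply: eq_integral => x _.
    by congr (sqnorm _)%:E; apply: eq_bigr => j _; rewrite mulrA.
  under eq_integral do rewrite E.
  apply: (@le_trans _ _ (\int[mu]_y (2 * pi * B * S)%:E)%E); last first.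
    rewrite integral_cst// [X in (_ * X)%E]torus_measureT -EFinM lee_fin.
    by rewrite le_eqVlt; apply/orP; left; apply/eqP; ring.
  apply: ae_ge0_le_integral => //.
  - move=> y _; rewrite lee_fin mulr_ge0//; first by lra.
    by apply: sumr_ge0 => j _; rewrite mulr_ge0 ?sqnorm_ge0.
  - apply/measurable_EFinP/measurable_funM => //.
    apply: measurable_sum => j; apply: measurable_funM => //.
    exact/measurable_sqnorm/ccontinuous_measurable.
  - move=> y _; rewrite lee_fin !mulr_ge0 ?sumr_ge0//; try lra.
    by move=> j _; rewrite sqnorm_ge0.
  - apply: (@filterS _ _ ae_filter_torus _ _ _ ae_torus) => y yD _.
    rewrite lee_fin -[leRHS]mulrA ler_wpM2l//; first by lra.
    rewrite mulr_sumr; apply: ler_sum => j _; rewrite mulrC.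
    have [->|c0] := eqVneq (c j) 0; first by rewrite sqnorm0 !mulr0.
    by rewrite ler_wpM2r ?sqnorm_ge0// tB.
have dF x : is_cderive (F s x) (F s' x).
  apply: (@is_cderive_sum n (fun j y => c j * (s j y * mode j x))
    (fun j y => c j * (s' j y * mode j x))) => j.
  exact: is_cderiveM_cst.
have cF' x : ccontinuous (F s' x).
  apply: (@ccontinuous_sum _ n (fun j y => c j * (s' j y * mode j x))) => j.
  apply: ccontinuousM; first exact: ccontinuous_cst.
  by apply: ccontinuousM => //; exact: ccontinuous_cst.
have mI (t : nat -> R -> R[i]) : (forall j, ccontinuous (t j)) ->
    measurable_fun setT (fun x => \int[mu]_y (sqnorm (F t x y))%:E)%E.
  move=> ct; apply: (@measurable_fun_fubini_tonelli_F _ _ _ _ _ mu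
    (fun z : R * R => (sqnorm (F t z.1 z.2))%:E)); first exact: mF.
  by move=> z; rewrite lee_fin sqnorm_ge0.
have h1 : (0 <= (1 + 2 * pi / h)%:E)%E.
  by rewrite lee_fin addr_ge0// mulr_ge0 ?invr_ge0 ?(ltW h0)//; lra.
have h2 : (0 <= (2 * pi * h)%:E)%E by rewrite lee_fin mulr_ge0 ?(ltW h0)//; lra.
have mFs : measurable_cfun (fun x => F s x x).
  apply: (@measurable_cfun_sum _ _ _ n (fun j x => c j * (s j x * mode j x))) => j.
  apply: measurable_cfunM; first exact: measurable_cfun_cst.
  by apply: measurable_cfunM => //; exact: ccontinuous_measurable.
have key : ((2 * pi)%:E * sqint mu (fun x => F s x x) <=
    (1 + 2 * pi / h)%:E * (\int[mu]_x \int[mu]_y (sqnorm (F s x y))%:E) +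
    (2 * pi * h)%:E * (\int[mu]_x \int[mu]_y (sqnorm (F s' x y))%:E))%E.
  have I0 (t : nat -> R -> R[i]) x : (0 <= \int[mu]_y (sqnorm (F t x y))%:E)%E.
    by apply: integral_ge0 => y _; rewrite lee_fin sqnorm_ge0.
  rewrite -!ge0_integralZl//; last 5 first.
  - exact: mI.
  - exact: mI.
  - exact: measurable_Esqnorm.
  - by move=> y _; rewrite lee_fin sqnorm_ge0.
  - by rewrite lee_fin; lra.
  rewrite -ge0_integralD//; last 4 first.
  - by move=> x _; exact: mule_ge0.
  - by apply: measurable_funeM; exact: mI.
  - by move=> x _; exact: mule_ge0.
  - by apply: measurable_funeM; exact: mI.
  apply: ae_ge0_le_integral => //.
  - by move=> x _; rewrite -EFinM lee_fin mulr_ge0 ?sqnorm_ge0//; lra.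
  - by apply: measurable_funeM; exact: measurable_Esqnorm.
  - by move=> x _; rewrite adde_ge0// mule_ge0.
  - by apply: emeasurable_funD; apply: measurable_funeM; exact: mI.
  - apply: (@filterS _ _ ae_filter_torus _ _ _ ae_torus) => x xD _.
    by rewrite -EFinM; exact: (sobolev_torus (dF x) (cF' x) h0 xD).
have {}key := le_trans key (leeD (lee_wpmul2l h1 (bF s A A0 cs sA))
  (lee_wpmul2l h2 (bF s' C C0 cs' (fun j x _ => sC j x)))).
have pi2 : 0 < 2 * pi :> R by lra.
rewrite -(@lee_pmul2l _ (2 * pi)%:E)// ?lte_fin//; apply: (le_trans key).
rewrite -!EFinM -EFinD lee_fin le_eqVlt; apply/orP; left; apply/eqP.
by field; rewrite gt_eqF.
Qed.

End Sobolev.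

(** * Trigonometric polynomials *)

Section TrigPolynomials.
Context {R : realType}.
Local Notation mu := (@torus_measure R).

Definition trig_poly (n : nat) (c : nat -> R[i]) (x : R) : R[i] :=
  \sum_(j < n) c j * mode j x.

(** The coefficients beyond the degree are required to vanish, so that two
    polynomials can be written with a common degree. *)
Definition is_trig (p : R -> R[i]) : Prop :=
  exists n c, (forall j, (n <= j)%N -> c j = 0) /\ p = trig_poly n c.

Lemma trig_poly_widen n N (c : nat -> R[i]) : (n <= N)%N ->
  (forall j, (n <= j)%N -> c j = 0) -> trig_poly N c = trig_poly n c.
Proof.
move=> nN c0; apply/funext => x; rewrite /trig_poly.
rewrite (big_ord_widen N (fun j => c j * mode j x) nN) [LHS](bigID (fun j : 'I_N => (j < n)%N)) /=.
rewrite [X in _ + X]big1 ?addr0// => j; rewrite -leqNgt => nj.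
by rewrite c0// mul0r.
Qed.

Lemma is_trig0 : is_trig (fun=> 0).
Proof.
exists 0, (fun=> 0); split => //; apply/funext => x.
by rewrite /trig_poly big_ord0.
Qed.

Lemma is_trigD p q : is_trig p -> is_trig q -> is_trig (fun x => p x + q x).
Proof.
move=> [n [c [c0 ->]]] [m [d [d0 ->]]].
exists (maxn n m), (fun j => c j + d j); split => [j|].
  by rewrite geq_max => /andP[nj mj]; rewrite c0// d0// addr0.
apply/funext => x.
rewrite -(trig_poly_widen (leq_maxl n m) c0) -(trig_poly_widen (leq_maxr n m) d0).
by rewrite /trig_poly -big_split /=; apply: eq_bigr => j _; rewrite mulrDl.
Qed.

Lemma is_trigZ a p : is_trig p -> is_trig (fun x => a * p x).
Proof.
move=> [n [c [c0 ->]]]; exists n, (fun j => a * c j); split => [j nj|].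
  by rewrite c0// mulr0.
by apply/funext => x; rewrite /trig_poly mulr_sumr; apply: eq_bigr => j _; rewrite mulrA.
Qed.

Lemma is_trig_sum (I : Type) (r : seq I) (F : I -> R -> R[i]) :
  (forall i, is_trig (F i)) -> is_trig (fun x => \sum_(i <- r) F i x).
Proof.
move=> tF; elim: r => [|i r IHr].
  by under eq_fun do rewrite big_nil; exact: is_trig0.
by under eq_fun do rewrite big_cons; exact: is_trigD.
Qed.

Lemma is_trig_expi (m : int) : is_trig (fun x => expi (x * m%:~R)).
Proof.
have [k <-] := freq_surj m.
exists k.+1, (fun j => if j == k then 1 else 0); split => [j kj|].
  by rewrite ifF//; apply/negbTE; rewrite neq_ltn kj orbT.
apply/funext => x; rewrite /trig_poly big_ord_recr /= eqxx mul1r big1 ?add0r//.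
by move=> j _; rewrite ifF ?mul0r//; apply/negbTE; rewrite neq_ltn ltn_ord.
Qed.

Lemma is_trig_cos_sin (a b : R) (m : int) :
  is_trig (fun x => (a * cos (m%:~R * x) + b * sin (m%:~R * x))%:C).
Proof.
(* a cos t + b sin t = (a - ib)/2 e^{it} + (a + ib)/2 e^{-it} *)
have -> : (fun x => (a * cos (m%:~R * x) + b * sin (m%:~R * x))%:C) =
  (fun x => ((a / 2) +i* (- b / 2)) * expi (x * m%:~R) +
            ((a / 2) +i* (b / 2)) * expi (x * (- m)%:~R)).
  apply/funext => x; rewrite intrN mulrN [_%:~R * x]mulrC /expi cosN sinN.
  by apply/eqP; rewrite eq_complex /=; apply/andP; split; apply/eqP; field.
by apply: is_trigD; apply: is_trigZ; exact: is_trig_expi.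
Qed.

Lemma is_trig_ccontinuous p : is_trig p -> ccontinuous p.
Proof.
move=> [n [c [_ ->]]].
apply: (@ccontinuous_sum _ n (fun j x => c j * mode j x)) => j.
by apply: ccontinuousM; [exact: ccontinuous_cst|exact: ccontinuous_expi].
Qed.

End TrigPolynomials.

(** * The Fejer means of a continuous function *)

Section Fejer.
Context {R : realType}.
Local Notation mu := (@torus_measure R).
Local Notation leb := (@lebesgue_measure R).
Local Notation tint f := (Rintegral leb `[- pi, pi] f).

Lemma integrable_itv_continuous (f : R -> R) : continuous f ->
  leb.-integrable `[- pi, pi] (EFin \o f).
Proof.
move=> cf; apply: continuous_compact_integrable; first exact: segment_compact.
exact: continuous_subspaceT.
Qed.

Lemma le_tint (f g : R -> R) : continuous f -> continuous g ->
  (forall y, - pi <= y <= pi -> f y <= g y) -> tint f <= tint g.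
Proof.
move=> cf cg fg; apply: le_Rintegral => //; try exact: integrable_itv_continuous.
Qed.

Lemma tint_sum (I : Type) (r : seq I) (F : I -> R -> R) :
  (forall i, continuous (F i)) ->
  tint (fun y => \sum_(i <- r) F i y) = \sum_(i <- r) tint (F i).
Proof.
move=> cF; rewrite /Rintegral; under eq_integral do rewrite -sumEFin.
rewrite integral_sum//; last by move=> i; exact: integrable_itv_continuous.
rewrite sum_fine// => i _.
by apply: integrable_fin_num => //; exact: integrable_itv_continuous.
Qed.

(** The Fejer kernel up to the factor 1 / n.  As a squared modulus it is
    nonnegative, and its integral is an instance of Parseval's identity. *)
Definition fejer_kernel (n : nat) (t : R) : R :=
  sqnorm (\sum_(j < n) expi (t * j%:R)).

Lemma fejer_kernel_ge0 n t : 0 <= fejer_kernel n t.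
Proof. exact: sqnorm_ge0. Qed.

(** 2 (1 - cos t) = |e^(it) - 1|^2, and multiplying the geometric sum by
    e^(it) - 1 leaves e^(int) - 1, of modulus at most 2.  Compared with the
    integral 2 pi n of the kernel, this shows that its mass concentrates where
    cos t = 1. *)
Lemma fejer_kernel_cos n t : (1 - cos t) * fejer_kernel n t <= 2.
Proof.
have expiX j : expi (t * j%:R) = expi t ^+ j.
  elim: j => [|j IHj]; first by rewrite mulr0 expi0.
  by rewrite -[j.+1%:R]natr1 mulrDr mulr1 expiD IHj exprSr.
have E s : sqnorm (expi s - 1) = 2 * (1 - cos s) :> R.
  have := cos2Dsin2 s; rewrite /sqnorm /=; nra.
have := sqnormM (expi t - 1) (\sum_(j < n) expi (t * j%:R)).
under eq_bigr do rewrite expiX.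
rewrite -subrX1 -expiX !E.
under eq_bigr do rewrite -expiX.
rewrite -/(fejer_kernel n t) => H.
have := cos_geN1 (t * n%:R); nra.
Qed.

Lemma fejer_kernelE n x y : fejer_kernel n (x - y) =
  \sum_(p : 'I_n * 'I_n)
    (cos ((p.1%:Z - p.2%:Z)%:~R * y) * cos ((p.1%:Z - p.2%:Z)%:~R * x) +
     sin ((p.1%:Z - p.2%:Z)%:~R * y) * sin ((p.1%:Z - p.2%:Z)%:~R * x)).
Proof.
rewrite /fejer_kernel (sqnorm_sum n (fun j => expi ((x - y) * j%:R))) pair_big /=.
apply: eq_bigr => -[j l] _ /=.
rewrite -cosB -mulrBr -[cos _ * cos _ + _]addrC -[RHS]addrC -cosB.
rewrite -[LHS]cosN; congr cos; rewrite intrB; ring.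
Qed.

Lemma continuous_fejer n x : continuous (fun y => fejer_kernel n (x - y)).
Proof.
apply: continuous_sqnorm.
apply: (@ccontinuous_sum _ n (fun j y => expi ((x - y) * j%:R))) => j.
have -> : (fun y => expi ((x - y) * j%:R)) =
  (fun y => expi (x * j%:R) * expi (y * (- j%:R))).
  by apply/funext => y; rewrite -expiD; congr expi; ring.
by apply: ccontinuousM; [exact: ccontinuous_cst|exact: ccontinuous_expi].
Qed.

Lemma tint_fejer n x : tint (fun y => fejer_kernel n (x - y)) = 2 * pi * n%:R.
Proof.
rewrite /Rintegral -integral_torus; last first.
  by apply/measurable_EFinP; apply: continuous_measurable_fun; exact: continuous_fejer.
have qI : injective (fun j : nat => - j%:Z) by move=> i j; lia.
have := parseval_sum n (fun j => expi (x * j%:R)) qI.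
rewrite /sqint => H.
rewrite (_ : (fun y => _) = (fun y => (sqnorm (\sum_(j < n)
   expi (x * j%:R) * expi (y * (- j%:Z)%:~R)))%:E)); last first.
  apply/funext => y; congr (sqnorm _)%:E; apply: eq_bigr => j _.
  by rewrite -expiD intrN; congr expi; ring.
rewrite H /=; congr (_ * _).
under eq_bigr do rewrite sqnorm_expi.
by rewrite sumr_const card_ord.
Qed.

Definition fejer_mean (n : nat) (g : R -> R) (x : R) : R :=
  (2 * pi * n%:R)^-1 * tint (fun y => fejer_kernel n (x - y) * g y).

(** The kernel is a combination of cos (m (x - y)), so the variables separate
    and the integrals in y become coefficients. *)
Lemma is_trig_fejer n (g : R -> R) : continuous g ->
  is_trig (fun x => (fejer_mean n g x)%:C).
Proof.
move=> cg; pose m (p : 'I_n * 'I_n) : int := p.1%:Z - p.2%:Z.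
pose A p := tint (fun y => cos ((m p)%:~R * y) * g y).
pose B p := tint (fun y => sin ((m p)%:~R * y) * g y).
have cc p : continuous (fun y : R => cos ((m p)%:~R * y) * g y).
  by move=> y; apply: cvgM; [exact: continuous_cosM|exact: cg].
have cs p : continuous (fun y : R => sin ((m p)%:~R * y) * g y).
  by move=> y; apply: cvgM; [exact: continuous_sinM|exact: cg].
have -> : (fun x => (fejer_mean n g x)%:C) = (fun x => ((2 * pi * n%:R)^-1)%:C *
   \sum_(p : 'I_n * 'I_n) (A p * cos ((m p)%:~R * x) + B p * sin ((m p)%:~R * x))%:C).
  apply/funext => x; rewrite -rmorph_sum -rmorphM; congr (_ * _)%:C.
  rewrite (_ : (fun y => _) = (fun y => \sum_(p : 'I_n * 'I_n)
     (cos ((m p)%:~R * x) * (cos ((m p)%:~R * y) * g y) +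
      sin ((m p)%:~R * x) * (sin ((m p)%:~R * y) * g y)))); last first.
    apply/funext => y; rewrite fejer_kernelE mulr_suml; apply: eq_bigr => p _.
    by rewrite -/(m p); ring.
  rewrite tint_sum => [|p y]; last first.
    by apply: cvgD; apply: cvgM; [exact: cvg_cst|exact: cc|exact: cvg_cst|exact: cs].
  apply: eq_bigr => p _; rewrite RintegralD//; last 2 first.
  - by apply: integrable_itv_continuous => y; apply: cvgM; [exact: cvg_cst|exact: cc].
  - by apply: integrable_itv_continuous => y; apply: cvgM; [exact: cvg_cst|exact: cs].
  rewrite !RintegralZl//; try exact: integrable_itv_continuous.
  by congr (_ + _); rewrite mulrC.
by apply: is_trigZ; apply: is_trig_sum => p; exact: is_trig_cos_sin.
Qed.

Lemma fejer_mean_bounded n g M x : continuous g -> (0 < n)%N ->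
  (forall y, `|g y| <= M) -> `|fejer_mean n g x| <= M.
Proof.
move=> cg n0 gM; have pi0 := pi_gt0 R.
have N0 : 0 < 2 * pi * n%:R :> R by rewrite mulr_gt0 ?ltr0n//; lra.
rewrite /fejer_mean normrM gtr0_norm ?invr_gt0// mulrC ler_pdivrMr// mulrC.
have cK := @continuous_fejer n x.
have cKg : continuous (fun y => fejer_kernel n (x - y) * g y).
  by move=> y; apply: cvgM; [exact: cK|exact: cg].
apply: (le_trans (le_normr_Rintegral _ (integrable_itv_continuous cKg))) => //.
rewrite -(tint_fejer n x) mulrC -RintegralZl//; last exact: integrable_itv_continuous.
apply: le_tint.
- by move=> y; apply: cvg_norm; exact: cKg.
- by move=> y; apply: cvgM; [exact: cvg_cst|exact: cK].
- move=> y _; rewrite normrM (ger0_norm (fejer_kernel_ge0 _ _)) mulrC.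
  by rewrite ler_wpM2r// fejer_kernel_ge0.
Qed.

(** Korovkin's argument: |g(y) - g(x)| is at most e/2 near x and at most
    2M <= (2M / w) (1 - cos (x - y)) elsewhere, and the integral of
    (1 - cos) times the kernel is bounded independently of n.  The point x must
    be interior because g need not be periodic: near the end points of
    [-pi, pi], a point y close to the other end point has cos (x - y) close
    to 1 although g(y) may be far from g(x). *)
Lemma fejer_mean_cvg g M x : continuous g -> (forall y, `|g y| <= M) ->
  - pi < x < pi -> fejer_mean n.+1 g x @[n --> \oo] --> g x.
Proof.
move=> cg gM /andP[x1 x2]; have pi0 := pi_gt0 R.
have M0 : 0 <= M by exact: le_trans (normr_ge0 _) (gM 0).
apply/cvgrPdist_le => e e0.
have /cvgrPdist_le/(_ (e / 2)) := cg x.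
have e20 : 0 < e / 2 by lra.
move=> /(_ e20)[/= d d0 gd].
pose d' := Num.min d (pi - `|x|) / 2.
have xpi : `|x| < pi by rewrite ltr_norml x1.
have d'0 : 0 < d' by rewrite divr_gt0// lt_min d0 subr_gt0.
have d'd : d' < d.
  have : Num.min d (pi - `|x|) <= d by rewrite ge_min lexx.
  by rewrite /d'; lra.
have d'x : d' < pi - `|x|.
  have : Num.min d (pi - `|x|) <= pi - `|x| by rewrite ge_min lexx orbT.
  by rewrite /d'; lra.
have d'pi : d' < pi by have := normr_ge0 x; lra.
pose w := 1 - cos d'.
have w0 : 0 < w.
  rewrite subr_gt0 -[ltRHS]cos0 ltr_cos// !in_itv /= ?lexx ?ltW//.
(* d' < pi - |x| keeps x - y away from the zeros 2 pi and - 2 pi of 1 - cos. *)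
have far y : - pi <= y <= pi -> `|g y - g x| <= e / 2 + 2 * M / w * (1 - cos (x - y)).
  move=> /andP[y1 y2].
  have c1 : 0 <= 1 - cos (x - y) by rewrite subr_ge0 cos_le1.
  have [near_|far_] := ltP `|x - y| d.
    have := gd y near_; rewrite distrC => /le_trans; apply.
    by rewrite lerDl !mulr_ge0 ?invr_ge0 ?(ltW w0).
  have cw : w <= 1 - cos (x - y).
    have cosle u : d' <= u <= pi -> cos u <= cos d'.
      move=> /andP[u1 u2]; have dI : d' \in `[0, pi] by rewrite in_itv /= (ltW d'0) ltW.
      have uI : u \in `[0, pi] by rewrite in_itv /= u2 andbT (le_trans (ltW d'0)).
      by rewrite leNgt ltr_cos// -leNgt.
    rewrite lerD2l lerN2.
    have -> : cos (x - y) = cos `|x - y|.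
      by have [_|_] := ler0P (x - y); rewrite ?cosN.
    have txpi : `|x - y| <= pi + `|x|.
      by rewrite (le_trans (ler_normB _ _))// addrC lerD2r ler_norml y1.
    have [tpi|pit] := leP `|x - y| pi.
      by apply: cosle; rewrite tpi andbT (le_trans (ltW d'd)).
    rewrite -[`|x - y|]opprK cosN -(@cosD2pi R) mulr2n; apply: cosle.
    by apply/andP; split; lra.
  apply: (@le_trans _ _ (2 * M)).
    by apply: (le_trans (ler_normB _ _)); rewrite mulr_natl mulr2n lerD.
  have : 2 * M / w * w <= 2 * M / w * (1 - cos (x - y)).
    by rewrite ler_wpM2l// !mulr_ge0// invr_ge0 ltW.
  rewrite divfK ?gt_eqF// => /le_trans; apply.
  by rewrite lerDr ltW.
pose Q := 4 * M / w.
have Q0 : 0 <= Q by rewrite !mulr_ge0// invr_ge0 ltW.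
near=> n.
have n0 : 0 < n.+1%:R :> R by rewrite ltr0n.
have Qn : Q / n.+1%:R <= e / 2.
  have : 2 * Q / e <= n%:R by near: n; exact: nbhs_infty_ger.
  by rewrite ler_pdivrMr// ler_pdivrMr// -[n.+1%:R]natr1 => Qe; lra.
have N0 : 0 < 2 * pi * n.+1%:R :> R by rewrite mulr_gt0//; lra.
have cK := @continuous_fejer n.+1 x.
have cD : continuous (fun y => fejer_kernel n.+1 (x - y) * (g y - g x)).
  move=> y; apply: cvgM; first exact: cK.
  by apply: cvgB; [exact: cg|exact: cvg_cst].
have -> : g x - fejer_mean n.+1 g x = - ((2 * pi * n.+1%:R)^-1 *
    tint (fun y => fejer_kernel n.+1 (x - y) * (g y - g x))).
  rewrite /fejer_mean.
  have -> : tint (fun y => fejer_kernel n.+1 (x - y) * (g y - g x)) =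
      tint (fun y => fejer_kernel n.+1 (x - y) * g y + (- g x) * fejer_kernel n.+1 (x - y)).
    by apply: eq_Rintegral => y _; ring.
  rewrite RintegralD//; last 2 first.
  - by apply: integrable_itv_continuous => y; apply: cvgM; [exact: cK|exact: cg].
  - by apply: integrable_itv_continuous => y; apply: cvgM; [exact: cvg_cst|exact: cK].
  rewrite RintegralZl//; last exact: integrable_itv_continuous.
  rewrite tint_fejer; set t := tint _; move: N0; set N := 2 * pi * _ => N0.
  by field; rewrite gt_eqF.
rewrite normrN normrM gtr0_norm ?invr_gt0// mulrC ler_pdivrMr//.
apply: (le_trans (le_normr_Rintegral _ (integrable_itv_continuous cD))) => //.
apply: (@le_trans _ _ (tint (fun y => e / 2 * fejer_kernel n.+1 (x - y) + Q))).
  apply: le_tint.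
  - by move=> y; apply: cvg_norm; exact: cD.
  - move=> y; apply: cvgD; last exact: cvg_cst.
    by apply: cvgM; [exact: cvg_cst|exact: cK].
  - move=> y yD; rewrite normrM (ger0_norm (fejer_kernel_ge0 _ _)).
    have K0 := fejer_kernel_ge0 n.+1 (x - y).
    apply: (le_trans (ler_wpM2l K0 (far y yD))).
    rewrite mulrDr [_ * (e / 2)]mulrC lerD2l mulrCA [_ * (1 - _)]mulrC.
    rewrite (_ : Q = 2 * M / w * 2); last by rewrite /Q; ring.
    by rewrite ler_wpM2l ?fejer_kernel_cos// !mulr_ge0// invr_ge0 ltW.
rewrite RintegralD//; last 2 first.
- by apply: integrable_itv_continuous => y; apply: cvgM; [exact: cvg_cst|exact: cK].
- by apply: integrable_itv_continuous => y; exact: cvg_cst.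
rewrite RintegralZl//; last exact: integrable_itv_continuous.
rewrite tint_fejer.
have -> : tint (fun=> Q) = Q * (2 * pi).
  have E := @torus_measureT R; rewrite /torus_measure /mrestr setTI in E.
  by rewrite /Rintegral integral_cst// [X in (_ * X)%E]E.
have -> : Q = Q / n.+1%:R * n.+1%:R by rewrite divfK// gt_eqF.
move: Qn; set q := Q / _ => Qn; nra.
Unshelve. all: by end_near.
Qed.

End Fejer.

(** * Density of the trigonometric polynomials *)

Section Density.
Context {R : realType}.
Local Notation mu := (@torus_measure R).
Local Notation leb := (@lebesgue_measure R).

Definition trig_approx (f : R -> R[i]) : Prop := forall e, 0 < e ->
  exists p, is_trig p /\ (sqint mu (fun x => (f x - p x)%R) <= e%:E)%E.

Lemma is_trig_measurable (p : R -> R[i]) : is_trig p -> measurable_cfun p.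
Proof. by move=> /is_trig_ccontinuous; exact: ccontinuous_measurable. Qed.

Lemma trig_approx_closed f : measurable_cfun f ->
  (forall e, 0 < e -> exists g, [/\ measurable_cfun g, trig_approx g &
     (sqint mu (fun x => (f x - g x)%R) <= e%:E)%E]) ->
  trig_approx f.
Proof.
move=> mf fg e e0; have e4 : 0 < e / 4 by lra.
have [g [mg /(_ _ e4)[p [tp gp]] fge]] := fg _ e4.
exists p; split => //; have mp := is_trig_measurable tp.
have -> : (fun x => f x - p x) = (fun x => (f x - g x) + (g x - p x)).
  by apply/funext => x; rewrite addrA subrK.
apply: (le_trans (sqintD_le mu (measurable_cfunB mf mg) (measurable_cfunB mg mp))).
apply: (@le_trans _ _ (2%:E * (e / 4)%:E + 2%:E * (e / 4)%:E)%E).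
  by apply: leeD; apply: lee_wpmul2l.
by rewrite -!EFinM -EFinD lee_fin; lra.
Qed.

(** Reduces complex-valued functions to their real and imaginary parts. *)
Lemma trig_approxDi f g : measurable_cfun f -> measurable_cfun g ->
  trig_approx f -> trig_approx g -> trig_approx (fun x => f x + 'i * g x).
Proof.
move=> mf mg tf tg e e0; have e4 : 0 < e / 4 by lra.
have [p [tp fp]] := tf _ e4; have [q [tq gq]] := tg _ e4.
exists (fun x => p x + 'i * q x); split.
  by apply: is_trigD => //; exact: is_trigZ.
have mp := is_trig_measurable tp; have mq := is_trig_measurable tq.
have -> : (fun x => f x + 'i * g x - (p x + 'i * q x)) =
    (fun x => (f x - p x) + 'i * (g x - q x)).
  by apply/funext => x; rewrite mulrBr opprD addrACA.
have mi : measurable_cfun (fun x => 'i * (g x - q x) : R[i]).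
  by apply: measurable_cfunM; [exact: measurable_cfun_cst|exact: measurable_cfunB].
apply: (le_trans (sqintD_le mu (measurable_cfunB mf mp) mi)).
rewrite sqintZ; last exact: measurable_cfunB.
have -> : sqnorm ('i : R[i]) = 1 by rewrite /sqnorm /= expr0n expr1n add0r.
rewrite mul1e.
apply: (@le_trans _ _ (2%:E * (e / 4)%:E + 2%:E * (e / 4)%:E)%E).
  by apply: leeD; apply: lee_wpmul2l.
by rewrite -!EFinM -EFinD lee_fin; lra.
Qed.

Lemma measurable_creal (f : R -> R) : measurable_fun setT f ->
  measurable_cfun (fun x => (f x)%:C).
Proof. by move=> mf; split => //; exact: measurable_cst. Qed.

Lemma sqnorm_creal (a : R) : sqnorm a%:C = a ^+ 2.
Proof. by rewrite /sqnorm /= expr0n addr0. Qed.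

Lemma ae_torus_interior : {ae mu, forall x : R, - pi < x < pi}.
Proof.
have neq (a : R) : {ae mu, forall x : R, x <> a}.
  exists [set a]; split => //; last by move=> x /= /contrapT.
  apply/eqP; rewrite eq_le measure_ge0 andbT -(lebesgue_measure_set1 a).
  by rewrite /torus_measure /mrestr le_measure// inE//; apply: measurableI.
have := @filterI _ _ ae_filter_torus _ _ ae_torus
  (@filterI _ _ ae_filter_torus _ _ (neq (- pi)) (neq pi)).
apply: (@filterS _ _ ae_filter_torus) => x [/andP[x1 x2] [/eqP n1 /eqP n2]].
by rewrite !lt_neqAle x1 x2 n2 eq_sym n1.
Qed.

Lemma small_integral (F : nat -> R -> R) (G : R -> R) e :
  (forall n, measurable_fun setT (F n)) ->
  mu.-integrable setT (EFin \o G) ->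
  (forall n x, 0 <= F n x <= G x) ->
  (forall x, - pi < x < pi -> F n x @[n --> \oo] --> 0) ->
  0 < e -> exists n, (\int[mu]_x (F n x)%:E <= e%:E)%E.
Proof.
move=> mF iG FG F0 e0.
have [|||||_ _] := @dominated_convergence _ _ _ mu setT measurableT
  (fun n x => (F n x)%:E) (cst 0%E) (EFin \o G).
- by move=> n; apply/measurable_EFinP; exact: mF.
- exact: measurable_cst.
- apply: (@filterS _ _ ae_filter_torus _ _ _ ae_torus_interior) => x xD _.
  by apply: cvg_EFin; [exact: nearW|exact: F0].
- exact: iG.
- apply: (@filterE _ _ ae_filter_torus) => x n _.
  have /andP[h1 h2] := FG n x.
  by rewrite /= lee_fin ger0_norm.
rewrite integral0 => H.
have : \forall n \near \oo, (\int[mu]_x (F n x)%:E < e%:E)%E.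
  apply: (H [set y | (y < e%:E)%E]); apply: open_nbhs_nbhs; split.
    exact: open_ereal_lt_ereal.
  by rewrite /= lte_fin.
by move=> [N _ /(_ N (leqnn _))/ltW]; exists N.
Qed.

(** The Fejer means converge almost everywhere and are bounded by the bound
    on g, so they converge in square mean by dominated convergence. *)
Lemma trig_approx_continuous (g : R -> R) M : continuous g ->
  (forall x, `|g x| <= M) -> trig_approx (fun x => (g x)%:C).
Proof.
move=> cg gM e e0.
have mfm n : measurable_fun setT (fejer_mean n g).
  have [m _] := is_trig_measurable (is_trig_fejer n cg).
  exact: m.
have mg : measurable_fun setT g by exact: continuous_measurable_fun.
have [||||n Hn] := @small_integral (fun n x => (g x - fejer_mean n.+1 g x) ^+ 2)
    (cst ((2 * M) ^+ 2)) e _ _ _ _ e0.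
- by move=> n; apply: measurable_funX; apply: measurable_funB.
- apply: integrable_torus_continuous; exact: cst_continuous.
- move=> n x; rewrite sqr_ge0 /= -[leLHS](real_normK (num_real _)).
  rewrite ler_pXn2r ?nnegrE//.
    apply: (le_trans (ler_normB _ _)); rewrite mulr_natl mulr2n lerD//.
    exact: fejer_mean_bounded.
  by rewrite mulr_ge0// (le_trans _ (gM x)).
- move=> x xD.
  have H : (g x - fejer_mean n.+1 g x) @[n --> \oo] --> (0 : R).
    rewrite -(subrr (g x)); apply: cvgB; first exact: cvg_cst.
    exact: fejer_mean_cvg gM xD.
  under eq_fun do rewrite expr2.
  by have := cvgM H H; rewrite mulr0; apply.

exists (fun x => (fejer_mean n.+1 g x)%:C); split; first exact: is_trig_fejer.
rewrite /sqint; under eq_integral do rewrite -rmorphB sqnorm_creal.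
exact: Hn.
Qed.

Definition clamp (M a : R) : R := Num.max (- M) (Num.min a M).

Lemma clamp_bounded M a : 0 <= M -> `|clamp M a| <= M.
Proof.
move=> M0; rewrite /clamp ler_norml le_max lexx ge_max ge_min lexx orbT andbT /=.
by lra.
Qed.

Lemma clamp_id M a : `|a| <= M -> clamp M a = a.
Proof.
rewrite ler_norml /clamp => /andP[a1 a2].
by rewrite (min_idPl a2) (max_idPr a1).
Qed.

(** Truncation is a contraction fixing [-M, M]: truncating an approximation
    of a function bounded by M does not worsen it. *)
Lemma clamp_dist M a b : `|a| <= M -> `|a - clamp M b| <= `|a - b|.
Proof.
rewrite ler_norml /clamp => /andP[a1 a2].
case: (leP b M) => bM; [case: (leP (- M) b)|case: (leP (- M) M)] => Mb;
  by rewrite ler_norml; case: (ler0P (a - b)) => ab; apply/andP; split; lra.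
Qed.

Lemma clamp_dist0 M a : 0 <= M -> `|a - clamp M a| <= `|a|.
Proof.
rewrite /clamp => M0.
case: (leP a M) => bM; [case: (leP (- M) a)|case: (leP (- M) M)] => Mb;
  by rewrite ler_norml; case: (ler0P a) => ab; apply/andP; split; lra.
Qed.

Lemma continuous_clamp M (g : R -> R) : continuous g ->
  continuous (fun x => clamp M (g x)).
Proof.
move=> cg x.
apply: (@continuous_max _ _ (fun=> - M) (fun y => Num.min (g y) M)).
  exact: cvg_cst.
by apply: (@continuous_min _ _ g (fun=> M)); [exact: cg|exact: cvg_cst].
Qed.

Lemma measurable_clamp M (g : R -> R) : measurable_fun setT g ->
  measurable_fun setT (fun x => clamp M (g x)).
Proof.
move=> mg; apply: (@measurableT_comp _ _ _ _ _ _ (clamp M) _ g) => //.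
apply: continuous_measurable_fun; apply: (@continuous_clamp M id).
by move=> x; exact: cvg_id.
Qed.

(** Continuous functions approximate f in L^1; once truncated, they also
    do so in square mean, since |f - g|^2 <= 2M |f - g| for functions bounded
    by M. *)
Lemma trig_approx_bounded (f : R -> R) M : measurable_fun setT f -> 0 < M ->
  (forall x, `|f x| <= M) -> trig_approx (fun x => (f x)%:C).
Proof.
move=> mf M0 fM; apply: trig_approx_closed; first exact: measurable_creal.
move=> e e0.
have finD : (leb `[(- pi)%R, pi] < +oo)%E.
  by have := @torus_measureT R; rewrite /torus_measure /mrestr setTI => ->; exact: ltry.
have [//|//||g [cg _ fg]] := @approximation_continuous_integrable R `[- pi, pi] f.
- apply: measurable_bounded_integrable => //; first exact: measurable_funTS.
  exists M; split; first exact: num_real.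
  by move=> N MN x _; exact: le_trans (fM x) (ltW MN).
- have e2 : 0 < e / (2 * M) by rewrite divr_gt0// mulr_gt0.
  have : \forall n \near \oo,
      (\int[leb]_(z in `[(- pi)%R, pi]) `|(f z - g n z)%:E| < (e / (2 * M))%:E)%E.
    apply: (fg [set y | (y < (e / (2 * M))%:E)%E]); apply: open_nbhs_nbhs; split.
      exact: open_ereal_lt_ereal.
    by rewrite /= lte_fin.
  move=> [n _ /(_ n (leqnn _)) /= /ltW Hn].
  have mg : measurable_fun setT (g n) by exact: continuous_measurable_fun.
  exists (fun x => (clamp M (g n x))%:C); split.
  + by apply: measurable_creal; apply: measurable_clamp.
  + apply: (@trig_approx_continuous _ M); first exact: continuous_clamp.
    by move=> x; exact/clamp_bounded/ltW.
  rewrite /sqint; under eq_integral do rewrite -rmorphB sqnorm_creal.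
  apply: (@le_trans _ _ (\int[mu]_x ((2 * M)%:E * `|(f x - g n x)%:E|))%E).
    apply: ge0_le_integral => //.
    * by move=> x _; rewrite lee_fin sqr_ge0.
    * apply/measurable_EFinP/measurable_funX/measurable_funB => //.
      exact: measurable_clamp.
    * apply: measurable_funeM; apply/measurable_EFinP/measurableT_comp => //.
      exact: measurable_funB.
    * move=> x _; rewrite -EFinM lee_fin -[leLHS](real_normK (num_real _)) expr2.
      apply: ler_pM => //; last exact: clamp_dist.
      apply: (le_trans (ler_normB _ _)); rewrite mulr_natl mulr2n lerD//.
      exact/clamp_bounded/ltW.
  rewrite ge0_integralZl//; last 2 first.
  + by apply/measurable_EFinP/measurableT_comp => //; exact: measurable_funB.
  + by rewrite lee_fin mulr_ge0// ltW.
  rewrite integral_torus; last first.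
    by apply/measurable_EFinP/measurableT_comp => //; exact: measurable_funB.
  apply: (@le_trans _ _ ((2 * M)%:E * (e / (2 * M))%:E)%E).
    by apply: lee_wpmul2l => //; rewrite lee_fin mulr_ge0// ltW.
  by rewrite -EFinM lee_fin mulrCA mulfV ?mulr1// gt_eqF// mulr_gt0.
Qed.

Lemma trig_approx_L2_real (f : R -> R) : measurable_fun setT f ->
  (\int[mu]_x (f x ^+ 2)%:E < +oo)%E -> trig_approx (fun x => (f x)%:C).
Proof.
move=> mf f2; apply: trig_approx_closed; first exact: measurable_creal.
move=> e e0.
have [||||n Hn] := @small_integral (fun n x => (f x - clamp n.+1%:R (f x)) ^+ 2)
    (fun x => f x ^+ 2) e _ _ _ _ e0.
- by move=> n; apply/measurable_funX/measurable_funB => //; exact: measurable_clamp.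
- apply/integrableP; split; first exact/measurable_EFinP/measurable_funX.
  apply: le_lt_trans f2; rewrite le_eqVlt; apply/orP; left; apply/eqP.
  by apply: eq_integral => x _; rewrite /= ger0_norm// sqr_ge0.
- move=> n x; rewrite sqr_ge0 /= -[leLHS](real_normK (num_real _)).
  rewrite -[leRHS](real_normK (num_real _)) ler_pXn2r ?nnegrE//.
  exact: clamp_dist0.
- move=> x _; apply: cvg_near_cst; near=> n.
  rewrite clamp_id ?subrr ?expr0n//.
  apply: (@le_trans _ _ n%:R); last by rewrite ler_nat.
  by near: n; exact: nbhs_infty_ger.
exists (fun x => (clamp n.+1%:R (f x))%:C); split.
- by apply: measurable_creal; apply: measurable_clamp.
- apply: (@trig_approx_bounded _ n.+1%:R) => //; first exact: measurable_clamp.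
  by move=> x; exact: clamp_bounded.
- rewrite /sqint; under eq_integral do rewrite -rmorphB sqnorm_creal.
  exact: Hn.
Unshelve. all: by end_near.
Qed.

Lemma trig_approx_L2 (f : R -> R[i]) : inL2 f -> trig_approx f.
Proof.
move=> /inL2P[[m1 m2] fin].
have part (g : R -> R) : measurable_fun setT g -> (forall x, g x ^+ 2 <= sqnorm (f x)) ->
    (\int[mu]_x (g x ^+ 2)%:E < +oo)%E.
  move=> mg gf; apply: le_lt_trans fin; apply: ge0_le_integral => //.
  - by move=> x _; rewrite lee_fin sqr_ge0.
  - exact/measurable_EFinP/measurable_funX.
  - exact: measurable_Esqnorm.
  - by move=> x _; rewrite lee_fin.
have -> : f = (fun x => (complex.Re (f x))%:C + 'i * (complex.Im (f x))%:C).
  apply/funext => x; case: (f x) => a b.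
  by apply/eqP; rewrite eq_complex /=; apply/andP; split; apply/eqP; ring.
apply: trig_approxDi.
- exact: measurable_creal.
- exact: measurable_creal.
- apply: trig_approx_L2_real => //; apply: part => // x.
  by rewrite lerDl sqr_ge0.
- apply: trig_approx_L2_real => //; apply: part => // x.
  by rewrite lerDr sqr_ge0.
Qed.

End Density.

(** * Completeness for the square integral *)

Lemma geometric_increments_cvg (R : realType) (a : nat -> R) (C : R) :
  (forall k, `|a k.+1 - a k| * 2 ^+ k <= C) -> cvgn a.
Proof.
move=> aC.
have C0 : 0 <= C by apply: le_trans (aC 0%N); rewrite mulr_ge0.
have H : cvgn (series (telescope a)).
  apply: normed_cvg.
  apply: (@series_le_cvg _ _ (geometric C 2^-1)) => [n|n|n|].
  - exact: normr_ge0.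
  - by rewrite /= mulr_ge0// exprn_ge0// invr_ge0.
  - by rewrite /= exprVn ler_pdivlMr ?exprn_gt0//; exact: aC.
  - apply: is_cvg_geometric_series.
    by rewrite ger0_norm ?invr_ge0// invf_lt1// ltr1n.
rewrite (_ : a = (fun n => a 0%N + series (telescope a) n)).
  by apply: is_cvgD => //; exact: is_cvg_cst.
by apply/funext => n; exact: eq_sum_telescope.
Qed.

Section Completeness.
Context d (T : measurableType d) (R : realType).
Variable mu : {measure set T -> \bar R}.

Definition sqint_cvg (u : nat -> T -> R[i]) (g : T -> R[i]) : Prop :=
  forall e, 0 < e -> exists N, forall n, (N <= n)%N ->
    (sqint mu (fun x => (u n x - g x)%R) <= e%:E)%E.

Definition sqint_cauchy (u : nat -> T -> R[i]) : Prop :=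
  forall e, 0 < e -> exists N, forall m n, (N <= m)%N -> (N <= n)%N ->
    (sqint mu (fun x => (u m x - u n x)%R) <= e%:E)%E.

(** Fatou's lemma, in the form in which a bound passes to an almost everywhere
    limit. *)
Lemma sqint_fatou (w : nat -> T -> R[i]) (f : T -> R[i]) e :
  (forall n, measurable_cfun (w n)) -> measurable_cfun f ->
  (forall n, (sqint mu (w n) <= e%:E)%E) ->
  {ae mu, forall x, sqnorm (w n x) @[n --> \oo] --> sqnorm (f x)} ->
  (sqint mu f <= e%:E)%E.
Proof.
move=> mw mf we wf.
have -> : sqint mu f = (\int[mu]_x limn_einf (fun n => (sqnorm (w n x))%:E))%E.
  apply: ae_eq_integral => //.
  - exact: measurable_Esqnorm.
  - under eq_fun do rewrite /limn_einf.
    apply: measurableT_comp => //; apply: measurable_fun_limn_esup => n.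
    by apply: measurableT_comp => //; exact: measurable_Esqnorm.
  - apply: filterS wf => x wx _.
    have /cvg_limn_einf_sup[-> _] // :
      (sqnorm (w n x))%:E @[n --> \oo] --> (sqnorm (f x))%:E.
    by apply: cvg_EFin; [exact: nearW|].
apply: le_trans (fatou _ _ _ _) _ => //.
- by move=> n; exact: measurable_Esqnorm.
- by move=> n x _; rewrite lee_fin sqnorm_ge0.
rewrite limn_einf_lim; apply: lime_le; first exact: is_cvg_einfs.
apply: nearW => n; apply: le_trans (we n); apply: ereal_inf_lbound.
by exists n => //=.
Qed.

(** The Riesz-Fischer argument: along a subsequence v with
    int |v_(k+1) - v_k|^2 <= 4^-k 2^-(k+1), the sum of the
    4^k |v_(k+1) - v_k|^2 has a finite integral, hence is finite almost
    everywhere, and there v converges geometrically.  The limit is defined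
    through the upper limit, which is measurable even where v diverges; that it
    is a limit in square mean follows from [sqint_fatou]. *)
Lemma sqint_complete (u : nat -> T -> R[i]) :
  (forall n, measurable_cfun (u n)) -> sqint_cauchy u ->
  exists g, measurable_cfun g /\ sqint_cvg u g.
Proof.
move=> mu_ cu.
pose eps k : R := (4 ^+ k)^-1 / 2 ^+ k.+1.
have eps0 k : 0 < eps k by rewrite divr_gt0 ?invr_gt0 ?exprn_gt0.
have [N0 HN0] := choice (fun k => cu _ (eps0 k)).
pose phi := fix phi k := if k is k'.+1 then (maxn (N0 k) (phi k')).+1 else N0 0%N.
have phiS k : (phi k < phi k.+1)%N by rewrite /= ltnS leq_maxr.
have phiN k : (N0 k <= phi k)%N.
  by case: k => [|k] /=; rewrite ?leqnn// ltnW// ltnS leq_maxl.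
have phik k : (k <= phi k)%N.
  by elim: k => [//|k IHk]; exact: leq_ltn_trans IHk (phiS k).
pose v k := u (phi k).
have mv k : measurable_cfun (v k) by exact: mu_.
have dv k : (sqint mu (fun x => (v k.+1 x - v k x)%R) <= (eps k)%:E)%E.
  by apply: HN0; rewrite ?phiN// (leq_trans (phiN k))// ltnW.
pose h k x := 4 ^+ k * sqnorm (v k.+1 x - v k x).
have h0 k x : 0 <= h k x by rewrite mulr_ge0 ?exprn_ge0 ?sqnorm_ge0.
have mh k : measurable_fun setT (fun x => (h k x)%:E).
  apply/measurable_EFinP; apply: measurable_funM => //.
  exact/measurable_sqnorm/measurable_cfunB.
pose S x := (\sum_(k <oo) (h k x)%:E)%E.
have S0 x : (0 <= S x)%E by apply: nneseries_ge0 => k _ _; rewrite lee_fin.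
have intS : (\int[mu]_x S x <= 1%:E)%E.
  rewrite /S integral_nneseries//; last by move=> k x _; rewrite lee_fin.
  apply: (@le_trans _ _ (\sum_(k <oo) (1 / (2 ^ (k + 1))%:R)%:E)%E); last first.
    have := cvg_lim (@ereal_hausdorff R) (@cvg_geometric_eseries_half R 1 0).
    by rewrite expr0 divr1 => <-.
  apply: lee_nneseries => [k _ _|k _].
    by apply: integral_ge0 => x _; rewrite lee_fin.
  under eq_integral do rewrite EFinM.
  rewrite ge0_integralZl//; last 2 first.
  - exact/measurable_Esqnorm/measurable_cfunB.
  - by move=> x _; rewrite lee_fin sqnorm_ge0.
  apply: (@le_trans _ _ ((4 ^+ k)%:E * (eps k)%:E)%E); last first.
    by rewrite -EFinM lee_fin /eps mulrA mulfV// natrX addn1.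
  by apply: lee_wpmul2l; [rewrite lee_fin exprn_ge0|exact: dv].
have iS : mu.-integrable setT S.
  apply/integrableP; split.
    by apply: ge0_emeasurable_sum => // k x _ _; rewrite lee_fin.
  apply: (@le_lt_trans _ _ 1%:E); last exact: ltry.
  by under eq_integral do rewrite gee0_abs//.
have cvg_v : {ae mu, forall x, cvgn (fun k => complex.Re (v k x)) /\
    cvgn (fun k => complex.Im (v k x))}.
  apply: filterS (integrable_ae measurableT iS) => x /(_ Logic.I) Sx.
  have hS k : h k x <= fine (S x).
    rewrite -lee_fin fineK// /S (@nneseriesD1 _ _ k)//.
      by rewrite leeDl// nneseries_ge0// => j _ _; rewrite lee_fin.
    by move=> j _; rewrite lee_fin.
  have comp (a : nat -> R) : (forall k, (a k.+1 - a k) ^+ 2 <= sqnorm (v k.+1 x - v k x)) ->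
      cvgn a.
    move=> av; apply: (@geometric_increments_cvg _ _ (1 + fine (S x))) => k.
    have := le_trans (ler_wpM2l (exprn_ge0 k (ler0n R 4)) (av k)) (hS k).
    have -> : 4 ^+ k = (2 ^+ k) ^+ 2 :> R.
      by rewrite -exprM mulnC exprM; congr (_ ^+ _); ring.
    rewrite -(real_normK (num_real (a k.+1 - a k))) -exprMn mulrC.
    set t := _ * _ => tS; have := sqr_ge0 (t - 1); nra.
  by split; apply: comp => k; case: (v k.+1 x) => a b; case: (v k x) => a' b';
    rewrite /sqnorm /= ?lerDl ?lerDr sqr_ge0.
pose L (a : nat -> R) : R := fine (limn_esup (fun k => (a k)%:E)).
pose g x : R[i] := L (fun k => complex.Re (v k x)) +i* L (fun k => complex.Im (v k x)).
have mg : measurable_cfun g.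
  split; rewrite /comp /g /=; apply: measurableT_comp => //;
    apply: measurable_fun_limn_esup => k; apply/measurable_EFinP;
    by case: (mv k).
have LE a : cvgn a -> a @ \oo --> L a.
  move=> ca; have : (a k)%:E @[k --> \oo] --> (limn a)%:E.
    by apply: cvg_EFin; [exact: nearW|].
  by rewrite /L => /cvg_limn_einf_sup[_ ->].
exists g; split => // e e0; have [N HN] := cu e e0.
exists N => n Nn.
apply: (@sqint_fatou (fun k x => u n x - v (k + N)%N x)) => [k||k|].
- exact: measurable_cfunB.
- exact: measurable_cfunB.
- by apply: HN => //; rewrite (leq_trans _ (phik _))// leq_addl.
- apply: filterS cvg_v => x [/LE c1 /LE c2].
  have c1' : (complex.Re (v (k + N)%N x)) @[k --> \oo] --> complex.Re (g x).
    by rewrite (@cvg_shiftn N _ (fun k => complex.Re (v k x))).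
  have c2' : (complex.Im (v (k + N)%N x)) @[k --> \oo] --> complex.Im (g x).
    by rewrite (@cvg_shiftn N _ (fun k => complex.Im (v k x))).
  have ReB (z w : R[i]) : complex.Re (z - w) = complex.Re z - complex.Re w.
    by case: z => ? ?; case: w.
  have ImB (z w : R[i]) : complex.Im (z - w) = complex.Im z - complex.Im w.
    by case: z => ? ?; case: w.
  rewrite /sqnorm; under eq_fun do rewrite ReB ImB !expr2.
  rewrite ReB ImB !expr2.
  by apply: cvgD; apply: cvgM; apply: cvgB => //; exact: cvg_cst.
Qed.

End Completeness.

(** * Diagonal extraction *)

(** A bounded sequence of real sequences has a cluster point l in the product
    topology, by Tychonoff; the n-th term of the subsequence is chosen within
    1 / (n+1) of l in its first n coordinates. *)
Lemma diagonal_subsequence (R : realType) (a : nat -> nat -> R) (M : R) :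
  (forall n i, `|a n i| <= M) ->
  exists (phi : nat -> nat) (l : nat -> R), increasing_seq phi /\
    forall J e, 0 < e -> exists N, forall n i, (N <= n)%N -> (i < J)%N ->
      `|a (phi n) i - l i| <= e.
Proof.
move=> aM.
have compactA := @tychonoff nat (fun=> R) (fun=> `[- M, M]%classic)
  (fun=> @segment_compact R (- M) M).
have [|l [_ clus]] := compactA (a @ \oo) _.
  exists 0%N => // n _ i /=; rewrite in_itv /= -ler_norml.
  exact: aM.
have step n m : exists k, (m < k)%N /\
    forall i, (i < n)%N -> `|a k i - l i| <= n.+1%:R^-1.
  have n0 : 0 < n.+1%:R^-1 :> R by rewrite invr_gt0 ltr0n.
  have nb k : nbhs (l : prod_topology (fun _ : nat => R))
      [set f : prod_topology (fun _ : nat => R) |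
       forall i, (i < k)%N -> `|f i - l i| <= n.+1%:R^-1].
    elim: k => [|k IHk]; first by apply: filterE.
    have : nbhs (l : prod_topology (fun _ : nat => R))
      [set f : prod_topology (fun _ : nat => R) | `|f k - l k| <= n.+1%:R^-1].
      apply: (@proj_continuous nat (fun=> R) k l [set y | `|y - l k| <= n.+1%:R^-1]).
      have /cvgrPdist_le/(_ _ n0) := @cvg_id R (nbhs (l k)).
      by apply: filterS => y; rewrite distrC.
    move=> H; apply: filterS (filterI IHk H) => f [f1 f2] i.
    by rewrite ltnS leq_eqVlt => /orP[/eqP->|/f1].
  have [|f [[k mk <-] fl]] := clus [set a k | k in [set k | (m < k)%N]] _ _ (nb n).
    by exists m.+1 => // k /= mk; exists k.
  by exists k.
have /choice[F HF] : forall nm : nat * nat, exists k, (nm.2 < k)%N /\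
    forall i, (i < nm.1)%N -> `|a k i - l i| <= nm.1.+1%:R^-1.
  by move=> [n m]; exact: step.
pose phi := fix phi n := if n is n'.+1 then F (n, phi n') else F (0%N, 0%N).
exists phi, l; split.
  by apply/increasing_seqP => n; have [] := HF (n.+1, phi n).
move=> J e e0.
exists (maxn J (Num.bound e^-1)) => n i; rewrite geq_max => /andP[Jn en] iJ.
have : `|a (phi n) i - l i| <= n.+1%:R^-1.
  case: n Jn en => [|n] Jn en.
    by have [_ H] := HF (0%N, 0%N); exact: H (leq_trans iJ Jn).
  by have [_ H] := HF (n.+1, phi n); exact: H (leq_trans iJ Jn).
move=> /le_trans; apply; rewrite -[leRHS]invrK lef_pV2 ?posrE ?invr_gt0 ?ltr0n//.
rewrite ltW// (@lt_le_trans _ _ (Num.bound e^-1)%:R)//.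
  by rewrite archi_boundP// invr_ge0 ltW.
by rewrite ler_nat leqW.
Qed.

(** * The L2 norm and the square integral *)

Section NormL2.
Context {R : realType}.
Local Notation mu := (@torus_measure R).
Implicit Types f g : R -> R[i].

Lemma normL2_fin f r : sqint mu f = r%:E -> normL2 f = (Num.sqrt r)%:E.
Proof.
move=> fr; rewrite normL2E fr poweR_EFin powR12_sqrt//.
by rewrite -lee_fin -fr sqint_ge0.
Qed.

Lemma normL2_le f c : (normL2 f <= c%:E)%E -> (sqint mu f <= (c ^+ 2)%:E)%E.
Proof.
have := sqint_ge0 mu f.
case E : (sqint mu f) => [r| |] // r0; last first.
  by rewrite normL2E E poweRyr ?leye_eq// invr_eq0.
rewrite (normL2_fin E) !lee_fin => rc.
by rewrite -(@sqr_sqrtr _ r)// ler_pXn2r ?nnegrE ?sqrtr_ge0// (le_trans (sqrtr_ge0 r)).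
Qed.

Lemma inL2_sqint f : inL2 f -> sqint mu f = (fine (sqint mu f))%:E.
Proof.
by move=> /inL2P[_ fin]; rewrite fineK// ge0_fin_numE// sqint_ge0.
Qed.

Lemma sqint_bounded_operator (T : (R -> R[i]) -> (R -> R[i])) :
  bounded_linear_operator T ->
  exists C, 0 <= C /\ forall f, inL2 f -> (sqint mu (T f) <= C%:E * sqint mu f)%E.
Proof.
move=> [TL _ [C TC]]; exists (C ^+ 2); split; first exact: sqr_ge0.
move=> f fL; have := TC f fL; have fr := inL2_sqint fL.
rewrite (normL2_fin fr) -EFinM => /normL2_le.
rewrite exprMn sqr_sqrtr ?EFinM -?fr//.
by rewrite fine_ge0// sqint_ge0.
Qed.

Lemma normL2_cvg0 (w : nat -> R -> R[i]) g :
  (forall n, inL2 (w n)) -> inL2 g ->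
  (normL2 (fun x => w n x - g x) @[n --> \oo] --> 0%E <-> sqint_cvg mu w g).
Proof.
move=> wL gL; split=> [H e e0|H].
  have se0 : 0 < Num.sqrt e by rewrite sqrtr_gt0.
  have [N _ HN] : \forall n \near \oo,
      (normL2 (fun x => (w n x - g x)%R) < (Num.sqrt e)%:E)%E.
    apply: (H [set y | (y < (Num.sqrt e)%:E)%E]); apply: open_nbhs_nbhs; split.
      exact: open_ereal_lt_ereal.
    by rewrite /= lte_fin.
  exists N => n /HN /ltW /normL2_le.
  by rewrite sqr_sqrtr// ltW.
have diffE n : sqint mu (fun x => w n x - g x) =
    (fine (sqint mu (fun x => w n x - g x)))%:E.
  have /inL2P[mw fw] := wL n; have /inL2P[mg fg] := gL.
  rewrite fineK// ge0_fin_numE ?sqint_ge0//.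
  under eq_fun do rewrite -mulN1r.
  have mNg : measurable_cfun (fun x => -1 * g x).
    by apply: measurable_cfunM => //; exact: measurable_cfun_cst.
  apply: (le_lt_trans (sqintD_le mu mw mNg)).
  by rewrite sqintZ// lte_add_pinfty// !lte_mul_pinfty// lee_fin sqnorm_ge0.
rewrite (_ : (fun n => _) = (fun n =>
  (Num.sqrt (fine (sqint mu (fun x => w n x - g x))))%:E)); last first.
  by apply/funext => n; exact: normL2_fin (diffE n).
apply: cvg_EFin; first exact: nearW.
apply/cvgrPdist_le => e e0.
have [N HN] := H (e ^+ 2) (exprn_gt0 2 e0).
exists N => // n /= /HN; rewrite diffE lee_fin => h.
rewrite sub0r normrN ger0_norm ?sqrtr_ge0//.
by rewrite -(ger0_norm (ltW e0)) -sqrtr_sqr ler_wsqrtr.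
Qed.

End NormL2.

(** * Bounds on the symbol *)

Section SymbolLimsup.
Context {R : realType}.
Variable sigma : R -> int -> R[i].

Lemma normcE (z : R[i]) : normc z = Num.sqrt (sqnorm z).
Proof. by case: z. Qed.

Lemma symbol_limsup_eq0 : symbol_limsup sigma = 0%E <->
  forall e : R, 0 < e -> exists N, forall k x, (N <= absz k)%N ->
    - pi <= x <= pi -> sqnorm (sigma x k) <= e.
Proof.
have piD : - pi <= (0 : R) <= pi by have := pi_ge0 R; rewrite oppr_le0 => ->.
split=> [d0 e e0|H].
  have : (symbol_limsup sigma < (Num.sqrt e)%:E)%E by rewrite d0 lte_fin sqrtr_gt0.
  move=> /ereal_inf_lt[_ [N _ <-] /ltW HN]; exists N => k x Nk xD.
  have : ((normc (sigma x k))%:E <= (Num.sqrt e)%:E)%E.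
    apply: le_trans HN.
    apply: (@le_trans _ _ (sup_norm_torus (sigma ^~ k))).
      by apply: ereal_sup_ubound; exists x => //=; rewrite in_itv.
    by apply: ereal_sup_ubound; exists k.
  by rewrite lee_fin normcE ler_sqrt ?(ltW e0).
apply/eqP; rewrite eq_le; apply/andP; split.
  apply/lee_addgt0Pr => e e0; rewrite add0e.
  have [N HN] := H (e ^+ 2) (exprn_gt0 2 e0).
  apply: ge_ereal_inf.
  exists (ereal_sup [set sup_norm_torus (sigma ^~ k) |
     k in [set k : int | (N <= absz k)%N]]); first by exists N.
  apply: ge_ereal_sup => _ [k /= Nk <-].
  apply: ge_ereal_sup => _ [x /= xD <-].
  rewrite in_itv /= in xD.
  rewrite lee_fin normcE -(ger0_norm (ltW e0)) -sqrtr_sqr ler_wsqrtr//.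
  exact: HN.
apply: le_ereal_inf_tmp => _ [N _ <-].
apply: (@le_trans _ _ (sup_norm_torus (sigma ^~ N%:Z))); last first.
  by apply: ereal_sup_ubound; exists N%:Z => /=.
apply: (@le_trans _ _ (normc (sigma 0 N%:Z))%:E).
  by rewrite lee_fin normcE sqrtr_ge0.
by apply: ereal_sup_ubound; exists 0 => //=; rewrite in_itv.
Qed.

End SymbolLimsup.

Section SymbolBounds.
Context {R : realType}.

Lemma is_derive_derive1n (f : R -> R) :
  (forall n x, derivable (derive1n n f) x 1) ->
  (forall x, is_derive x (1 : R) f (derive1n 1 f x)) /\ continuous (derive1n 1 f).
Proof.
move=> sf; split => x.
  have -> : derive1n 1 f x = 'D_1 f x by rewrite derive1n1 derive1E.
  exact/derivableP/(sf 0%N x).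
exact/differentiable_continuous/derivable1_diffP/(sf 1%N x).
Qed.

Lemma csmooth_is_cderive (f : R -> R[i]) : csmooth f ->
  is_cderive f (cderiv 1 f) /\ ccontinuous (cderiv 1 f).
Proof.
move=> sf.
have [d1 c1] := is_derive_derive1n (fun n x => (sf n x).1).
have [d2 c2] := is_derive_derive1n (fun n x => (sf n x).2).
split; first by move=> x; split; [exact: d1|exact: d2].
by split; [exact: c1|exact: c2].
Qed.

Lemma symbol_bounds (Lambda : int -> R) (rho : R) (sigma : R -> int -> R[i]) :
  symbolM Lambda rho 0 sigma ->
  [/\ forall k, is_cderive (sigma ^~ k) (cderiv 1 (sigma ^~ k)),
      forall k, ccontinuous (cderiv 1 (sigma ^~ k)) &
      exists B, [/\ 0 <= B, forall x k, sqnorm (sigma x k) <= B &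
        forall x k, sqnorm (cderiv 1 (sigma ^~ k) x) <= B]].
Proof.
move=> [smooth M]; split.
- by move=> k; have [_ /csmooth_is_cderive[]] := smooth k.
- by move=> k; have [_ /csmooth_is_cderive[]] := smooth k.
have S0 := M 0%N isT.
have E : (fun (x : R) (k : int) => k%:~R ^+ 0 * iter 0 Delta (sigma x) k) = sigma.
  by apply/funext => x; apply/funext => k; rewrite expr0 mul1r.
rewrite E in S0; case: S0 => _ S.
have bd beta : exists2 C, 0 < C & forall x k,
    sqnorm (cderiv beta (sigma ^~ k) x) <= C ^+ 2.
  have [C C0 HC] := S 0%N beta; exists C => // x k.
  have := HC x k; rewrite mulr0 subr0 powRr0 mulr1 => h.
  have n0 : 0 <= normc (cderiv beta (sigma ^~ k) x).
    by rewrite normcE sqrtr_ge0.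
  by rewrite -sqr_normc !expr2 ler_pM.
have [C0 C00 H0] := bd 0%N; have [C1 C10 H1] := bd 1%N.
exists (C0 ^+ 2 + C1 ^+ 2); split.
- by rewrite addr_ge0 ?sqr_ge0.
- move=> x k; apply: (@le_trans _ _ (C0 ^+ 2)); last by rewrite lerDl sqr_ge0.
  have := H0 x k; rewrite /cderiv /=.
  by case: (sigma x k).
- move=> x k; apply: (@le_trans _ _ (C1 ^+ 2)); last by rewrite lerDr sqr_ge0.
  exact: H1.
Qed.

End SymbolBounds.

(** * Bounded operators and their values on characters *)

Section L2Operators.
Context {R : realType}.
Local Notation mu := (@torus_measure R).
Variable T : (R -> R[i]) -> (R -> R[i]).
Hypothesis hT : bounded_linear_operator T.
Implicit Types f g : R -> R[i].

Lemma inL2_measurable f : inL2 f -> measurable_cfun f.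
Proof. by move=> /inL2P[]. Qed.

Lemma inL2_lincomb (a : R[i]) f g : inL2 f -> inL2 g -> inL2 (fun x => a * f x + g x).
Proof.
move=> /inL2P[mf ff] /inL2P[mg fg]; apply/inL2P.
have maf : measurable_cfun (fun x => a * f x).
  by apply: measurable_cfunM => //; exact: measurable_cfun_cst.
split; first exact: measurable_cfunD.
apply: (le_lt_trans (sqintD_le mu maf mg)).
by rewrite sqintZ// lte_add_pinfty// !lte_mul_pinfty// lee_fin sqnorm_ge0.
Qed.

Lemma inL2_cst (c : R[i]) : inL2 (fun=> c).
Proof. exact/inL2_ccontinuous/ccontinuous_cst. Qed.

Lemma inL2B f g : inL2 f -> inL2 g -> inL2 (fun x => f x - g x).
Proof.
move=> fL gL; have := inL2_lincomb (-1) gL fL.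
by under eq_fun do rewrite mulN1r addrC.
Qed.

Lemma inL2_sum n (c : nat -> R[i]) (F : nat -> R -> R[i]) :
  (forall j, inL2 (F j)) -> inL2 (fun x => \sum_(j < n) c j * F j x).
Proof.
move=> FL; elim: n => [|n IHn].
  by under eq_fun do rewrite big_ord0; exact: inL2_cst.
by under eq_fun do rewrite big_ord_recr /= addrC; exact: inL2_lincomb.
Qed.

Lemma operator_sum n (c : nat -> R[i]) (F : nat -> R -> R[i]) :
  (forall j, inL2 (F j)) ->
  eqL2 (T (fun x => \sum_(j < n) c j * F j x)) (fun x => \sum_(j < n) c j * T (F j) x).
Proof.
case: hT => _ lin _ FL; elim: n => [|n IHn].
  (* T 0 = T (-1 * 0 + 0) = - T 0 + T 0 *)
  have := lin (-1) _ _ (inL2_cst 0) (inL2_cst 0).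
  rewrite (_ : (fun x : R => -1 * 0 + 0) = fun=> 0); last first.
    by apply/funext => x; rewrite mulr0 addr0.
  rewrite (_ : (fun x : R => \sum_(j < 0) c j * F j x) = fun=> 0); last first.
    by apply/funext => x; rewrite big_ord0.
  apply: (@filterS _ _ ae_filter_torus) => x ->.
  by rewrite big_ord0 mulN1r addNr.
have := lin (c n) _ _ (FL n) (inL2_sum n c FL).
rewrite (_ : (fun x => \sum_(j < n.+1) c j * F j x) =
    (fun x => c n * F n x + \sum_(j < n) c j * F j x)); last first.
  by apply/funext => x; rewrite big_ord_recr /= addrC.
move=> H; apply: (@filterS _ _ ae_filter_torus _ _ _
  (@filterI _ _ ae_filter_torus _ _ H IHn)) => x [-> ->].
by rewrite big_ord_recr /= addrC.
Qed.

Lemma operatorB f g : inL2 f -> inL2 g ->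
  eqL2 (T (fun x => f x - g x)) (fun x => T f x - T g x).
Proof.
case: hT => _ lin _ fL gL; have := lin (-1) _ _ gL fL.
rewrite (_ : (fun x => -1 * g x + f x) = (fun x => f x - g x)); last first.
  by apply/funext => x; rewrite mulN1r addrC.
by apply: (@filterS _ _ ae_filter_torus) => x ->; rewrite mulN1r addrC.
Qed.

End L2Operators.

Section OperatorOnModes.
Context {R : realType}.
Local Notation mu := (@torus_measure R).
Variables (sigma : R -> int -> R[i]) (T : (R -> R[i]) -> (R -> R[i])).
Hypothesis hT : bounded_extension sigma T.

Lemma inL2_expi (m : R) : inL2 (fun x => expi (x * m)).
Proof. exact/inL2_ccontinuous/ccontinuous_expi. Qed.

Lemma sqint_expi (m : R) : sqint mu (fun x => expi (x * m)) = (2 * pi)%:E.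
Proof.
rewrite /sqint; under eq_integral do rewrite sqnorm_expi.
by rewrite integral_cst// [X in (_ * X)%E]torus_measureT mul1e.
Qed.

(** A character is smooth, so the extension agrees on it with the series
    defining the operator. *)
Lemma operator_expi (k : int) :
  eqL2 (T (fun x => expi (x * k%:~R))) (fun x => sigma x k * expi (x * k%:~R)).
Proof.
have := hT.2 _ (smooth_torus_expi k).
by apply: (@filterS _ _ ae_filter_torus) => x ->; exact: pseudo_diff_expi.
Qed.

Lemma operator_trig n (c : nat -> R[i]) :
  eqL2 (T (trig_poly n c))
       (fun x => \sum_(j < n) c j * (sigma x (freq j) * mode j x)).
Proof.
have H := operator_sum hT.1 n c (fun j => @inL2_expi (freq j)%:~R).
have Hj : {ae mu, forall x, forall j : 'I_n,
    T (mode j) x = sigma x (freq j) * mode j x}.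
  have := ae_foralln (fun j => operator_expi (freq j)).
  by apply: (@filterS _ _ ae_filter_torus) => x E j; exact: E.
apply: (@filterS _ _ ae_filter_torus _ _ _
  (@filterI _ _ ae_filter_torus _ _ H Hj)) => x [-> E].
by apply: eq_bigr => j _; rewrite E.
Qed.

End OperatorOnModes.

(** * A compact operator has a vanishing symbol at infinity *)

Section Necessity.
Context {R : realType}.
Local Notation mu := (@torus_measure R).

(** If the symbol does not vanish at infinity, the images of infinitely many
    characters have square integrals at least delta.  Compactness makes a
    sequence of them converge to some g, which must have G = int |g|^2 >=
    delta/2 - eps.  On the other hand M g is the sum of M terms g - T e_k, small
    by convergence, and of T (sum of M characters), whose square integral is
    O(M): hence G <= 2 eps + O(1 / M). *)
Lemma compact_symbol_limsup (sigma : R -> int -> R[i])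
    (T : (R -> R[i]) -> (R -> R[i])) (B : R) :
  bounded_extension sigma T ->
  (forall k, is_cderive (sigma ^~ k) (cderiv 1 (sigma ^~ k))) ->
  (forall k, ccontinuous (cderiv 1 (sigma ^~ k))) ->
  (forall x k, sqnorm (cderiv 1 (sigma ^~ k) x) <= B) -> 0 <= B ->
  compact_operator T -> symbol_limsup sigma = 0%E.
Proof.
move=> hT ds cs' s'B B0 cT; apply/symbol_limsup_eq0; apply: contrapT => notsmall.
have pi0 := pi_gt0 R.
have [e0 [e00 large]] : exists e0 : R, 0 < e0 /\ forall N, exists k x,
    [/\ (N <= absz k)%N, - pi <= x <= pi & e0 < sqnorm (sigma x k)].
  apply: contrapT => H; apply: notsmall => e e0.
  apply: contrapT => H2; apply: H; exists e; split => // N.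
  apply: contrapT => H3; apply: H2; exists N => k x Nk xD.
  by rewrite leNgt; apply/negP => es; apply: H3; exists k, x.
pose K k := sqint mu (fun x => sigma x k).
have cs k : ccontinuous (sigma ^~ k) by exact: is_cderive_continuous (ds k).
(* h is chosen so that the term with the derivative of the symbol is at most
   pi e0, half of the bound 2 pi e0 below the left-hand side of the
   Sobolev inequality. *)
pose h := e0 / (4 * pi * (B + 1)).
have h0 : 0 < h by rewrite divr_gt0// !mulr_gt0//; lra.
pose delta := pi * e0 / (1 + 2 * pi / h).
have den0 : 0 < 1 + 2 * pi / h by rewrite addr_gt0// divr_gt0//; lra.
have delta0 : 0 < delta by rewrite divr_gt0// mulr_gt0.
have lower k x : - pi <= x <= pi -> e0 < sqnorm (sigma x k) -> (delta%:E <= K k)%E.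
  move=> xD ex; have := sobolev_torus (ds k) (cs' k) h0 xD.
  have s'int : (sqint mu (cderiv 1 (sigma ^~ k)) <= (2 * pi * B)%:E)%E.
    apply: (@le_trans _ _ (\int[mu]_x B%:E)%E).
      apply: ge0_le_integral => //.
      - by move=> y _; rewrite lee_fin sqnorm_ge0.
      - exact/measurable_Esqnorm/ccontinuous_measurable.
      - by move=> y _; rewrite lee_fin.
    by rewrite integral_cst// [X in (_ * X)%E]torus_measureT -EFinM mulrC.
  have := inL2_sqint (inL2_ccontinuous (cs k)).
  rewrite -/(K k) => KE; move: s'int.
  have := inL2_sqint (inL2_ccontinuous (cs' k)); set b := fine _ => ->.
  rewrite KE; set a := fine _; rewrite -!EFinM -EFinD !lee_fin => bB H.
  rewrite /delta ler_pdivrMr//.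
  have e1 : 2 * pi * h * b <= 2 * pi * h * (2 * pi * B).
    have c1 : 0 < 2 * pi * h by rewrite mulr_gt0// mulr_gt0.
    exact: (ler_wpM2l (ltW c1)).
  have e2 : 2 * pi * h * (2 * pi * B) <= pi * e0.
    have -> : 2 * pi * h * (2 * pi * B) = pi * e0 * (B / (B + 1)).
      by rewrite /h; field; lra.
    have B1 : B / (B + 1) <= 1 by rewrite ler_pdivrMr ?mul1r; lra.
    by apply: ler_piMr => //; rewrite ltW// mulr_gt0.
  have e3 : 2 * pi * e0 < 2 * pi * sqnorm (sigma x k) by rewrite ltr_pM2l// mulr_gt0.
  rewrite [a * _]mulrC; lra.
have lower' J : exists j, (J <= j)%N /\ (delta%:E <= K (freq j))%E.
  have [k [x [Jk xD ex]]] := large J.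
  have [j jk] := freq_surj k; exists j; split; last by rewrite jk; exact: lower xD ex.
  rewrite (leq_trans Jk)// -jk; exact: freq_le.
have [F HF] := choice lower'.
pose jn := fix jn n := if n is n'.+1 then F (jn n').+1 else F 0%N.
have jn_lt n : (jn n < jn n.+1)%N by have [] := HF (jn n).+1.
have jn_inc : increasing_seq jn by apply/increasing_seqP.
have jn_low n : (delta%:E <= K (freq (jn n)))%E.
  by case: n => [|n] /=; [have [] := HF 0%N|have [] := HF (jn n).+1].
have [|phi [g [phi_inc gL]]] := cT (fun n => mode (jn n)) (fun n => inL2_expi _).
  exists (Num.sqrt (2 * pi)) => n.
  by rewrite (normL2_fin (sqint_expi _)).
pose q n := freq (jn (phi n)).
have qI : injective q.
  move=> m n /freq_inj /eqP; rewrite eq_le !jn_inc -!leEnat !phi_inc -eqn_leq.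
  by move=> /eqP.
have [TinL2 _ _] := hT.1.
have TL n : inL2 (T (mode (jn (phi n)))) by apply: TinL2; exact: inL2_expi.
move=> /(normL2_cvg0 TL gL) Tcvg.
have [C [C0 TC]] := sqint_bounded_operator hT.1.
have mg := inL2_measurable gL; have mT n := inL2_measurable (TL n).
pose G := fine (sqint mu g).
have GE : sqint mu g = G%:E by exact: inL2_sqint.
pose eps := delta / 16.
have eps0 : 0 < eps by rewrite divr_gt0.
have two0 : (0 <= 2%:E :> \bar R)%E by rewrite lee_fin.
have [N HN] := Tcvg eps eps0.
have Glow : delta / 2 - eps <= G.
  have h1 : (delta%:E <= sqint mu (T (mode (jn (phi N)))))%E.
    rewrite (@ae_eq_sqint _ _ _ mu _ _ (mT N) _ (operator_expi hT _)).
      rewrite (le_trans (jn_low (phi N)))// le_eqVlt; apply/orP; left; apply/eqP.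
      by apply: eq_integral => x _; rewrite sqnormM sqnorm_expi mulr1.
    apply: measurable_cfunM; first exact/ccontinuous_measurable.
    exact/ccontinuous_measurable/ccontinuous_expi.
  have h2 := sqintD_le mu (measurable_cfunB (mT N) mg) mg.
  rewrite (_ : (fun x => _ + g x) = T (mode (jn (phi N)))) in h2; last first.
    by apply/funext => x; rewrite subrK.
  have := le_trans h1 (le_trans h2 (leeD (lee_wpmul2l two0 (HN N (leqnn _))) (lexx _))).
  rewrite GE -!EFinM -EFinD lee_fin; lra.
have Gup M : (0 < M)%N -> G <= 2 * eps + 4 * pi * C / M%:R.
  move=> M0; pose w i := mode (R := R) (jn (phi (N + i)%N)).
  have wL i : inL2 (w i) by exact: inL2_expi.
  have TwL i : inL2 (T (w i)) by exact: TL.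
  have sumT : (sqint mu (fun x => (\sum_(i < M) 1 * T (w i) x)%R) <=
      (C * (2 * pi * M%:R))%:E)%E.
    have wsL := inL2_sum M (fun=> 1) wL.
    rewrite -(@ae_eq_sqint _ _ _ mu _ _ _ _ (operator_sum hT.1 M (fun=> 1) wL)).
    - apply: (le_trans (TC _ wsL)); rewrite EFinM lee_wpmul2l//.
      rewrite (@parseval_sum _ M (fun i => q (N + i)%N) (fun=> 1)); last first.
        by move=> i j /qI /addnI.
      rewrite (eq_bigr (fun=> 1)) ?sumr_const ?card_ord// => i _.
      by rewrite /sqnorm /= expr0n addr0 expr1n.
    - by apply: inL2_measurable; exact: TinL2.
    - by exact: inL2_measurable (inL2_sum M (fun=> 1) TwL).
  have sumD : (sqint mu (fun x => (\sum_(i < M) (g x - T (w i) x))%R) <=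
      (M%:R * (M%:R * eps))%:E)%E.
    apply: (le_trans (sqint_sum_le mu M (F := fun i x => g x - T (w i) x) _)).
      by move=> i; apply: measurable_cfunB => //; exact: mT.
    rewrite EFinM lee_wpmul2l//.
    apply: (@le_trans _ _ (\sum_(i < M) eps%:E)%E).
      by apply: lee_sum => i _; rewrite sqint_distC; apply: HN; rewrite leq_addr.
    by rewrite sumEFin sumr_const card_ord mulr_natl.
  have mD : measurable_cfun (fun x => \sum_(i < M) (g x - T (w i) x)).
    apply: (@measurable_cfun_sum _ _ _ M (fun i x => g x - T (w i) x)) => i.
    by apply: measurable_cfunB => //; exact: mT.
  have mS : measurable_cfun (fun x => \sum_(i < M) 1 * T (w i) x).
    by exact: inL2_measurable (inL2_sum M (fun=> 1) TwL).
  have := sqintD_le mu mD mS.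
  rewrite (_ : (fun x => _ + _) = (fun x => M%:R * g x)); last first.
    apply/funext => x; rewrite -big_split /=.
    rewrite (eq_bigr (fun=> g x)) => [|i _]; last by rewrite mul1r subrK.
    by rewrite sumr_const card_ord mulr_natl.
  rewrite sqintZ// sqnorm_natr GE => H.
  have {}H := le_trans H (leeD (lee_wpmul2l two0 sumD) (lee_wpmul2l two0 sumT)).
  rewrite -!EFinM -EFinD lee_fin in H.
  have M0' : 0 < M%:R :> R by rewrite ltr0n.
  rewrite -(@ler_pM2l _ (M%:R ^+ 2)) ?exprn_gt0//; apply: (le_trans H).
  by rewrite le_eqVlt; apply/orP; left; apply/eqP; field; rewrite gt_eqF.
have [M M0 HM] : exists2 M, (0 < M)%N & 4 * pi * C / M%:R <= eps.
  exists (Num.bound (4 * pi * C / eps)).+1 => //.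
  rewrite ler_pdivrMr// -[leLHS](@divfK _ eps) ?gt_eqF// [leRHS]mulrC ler_pM2r//.
  rewrite ltW// (@lt_le_trans _ _ (Num.bound (4 * pi * C / eps))%:R)//.
    rewrite archi_boundP//; apply: divr_ge0; last exact: ltW.
    by rewrite mulr_ge0// mulr_ge0// ltW.
  by rewrite ler_nat.
have := Gup M M0; move: Glow HM; rewrite /eps; lra.
Qed.

End Necessity.

(** * A symbol vanishing at infinity gives a compact operator *)

Lemma sqint_trig_poly (R : realType) n (c : nat -> R[i]) :
  sqint (@torus_measure R) (trig_poly n c) = (2 * pi * \sum_(j < n) sqnorm (c j))%:E.
Proof. by rewrite -(parseval_sum n c freq_inj). Qed.

Section Sufficiency.
Context {R : realType}.
Local Notation mu := (@torus_measure R).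
Variables (s s' : nat -> R -> R[i]) (B : R).
Hypotheses (ds : forall j, is_cderive (s j) (s' j))
  (cs' : forall j, ccontinuous (s' j)) (B0 : 0 <= B)
  (sB : forall j x, sqnorm (s j x) <= B) (s'B : forall j x, sqnorm (s' j x) <= B)
  (small : forall e, 0 < e -> exists J, forall j x, (J <= j)%N ->
    - pi <= x <= pi -> sqnorm (s j x) <= e).

Definition symbol_sum n (c : nat -> R[i]) (x : R) : R[i] :=
  \sum_(j < n) c j * (s j x * mode j x).

Lemma symbol_sum_continuous n c : ccontinuous (symbol_sum n c).
Proof.
apply: (@ccontinuous_sum _ n (fun j x => c j * (s j x * mode j x))) => j.
apply: ccontinuousM; first exact: ccontinuous_cst.
by apply: ccontinuousM; [exact: is_cderive_continuous (ds j)|exact: ccontinuous_expi].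
Qed.

(** In [symbol_sum_bound], h is chosen so that the term with the derivative is
    at most eta/2, and then the frequency threshold J so that |s_j|^2 is at
    most the value e making the other term equal to eta/2. *)
Lemma symbol_sum_tail eta : 0 < eta -> exists J, forall n (c : nat -> R[i]),
  (forall j, (j < J)%N -> c j = 0) ->
  (sqint mu (symbol_sum n c) <= (eta * \sum_(j < n) sqnorm (c j))%:E)%E.
Proof.
move=> eta0; have pi0 := pi_gt0 R.
have Bp : 0 < B + 1 by rewrite ltr_wpDl.
have pp : 0 < 8 * pi * pi * (B + 1) by rewrite mulr_gt0// mulr_gt0// mulr_gt0.
pose h := eta / (8 * pi * pi * (B + 1)).
have h0 : 0 < h by rewrite divr_gt0.
pose w := 1 + 2 * pi / h.
have w0 : 0 < w by rewrite addr_gt0// divr_gt0//; lra.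
pose e := eta / (4 * pi * w).
have e0 : 0 < e by rewrite divr_gt0// mulr_gt0//; lra.
have [J HJ] := small e0; exists J => n c c0.
apply: (le_trans (symbol_sum_bound n h0 (ltW e0) B0 ds cs' _ (fun j x _ => s'B j x))).
  move=> j x cj; apply: HJ; rewrite leqNgt; apply/negP => /c0 cj0.
  by rewrite cj0 eqxx in cj.
rewrite lee_fin ler_wpM2r//; first by apply: sumr_ge0 => j _; exact: sqnorm_ge0.
rewrite -/w.
have -> : 2 * pi * (w * e + 2 * pi * h * B) = eta / 2 + eta / 2 * (B / (B + 1)).
  rewrite /e /h; move: pi0 w0; generalize (pi : R) w => p v p0 v0.
  by field; rewrite !gt_eqF.
have B1 : B / (B + 1) <= 1 by rewrite ler_pdivrMr ?mul1r; lra.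
have : eta / 2 * (B / (B + 1)) <= eta / 2 by apply: ler_piMr => //; lra.
lra.
Qed.

Lemma symbol_sum_bounded : exists Q, 0 <= Q /\
  forall n (c : nat -> R[i]),
  (sqint mu (symbol_sum n c) <= (Q * \sum_(j < n) sqnorm (c j))%:E)%E.
Proof.
have pi0 := pi_gt0 R.
exists (2 * pi * ((1 + 2 * pi / 1) * B + 2 * pi * 1 * B)); split.
  by rewrite !mulr1 divr1 mulr_ge0 ?addr_ge0 ?mulr_ge0//; lra.
move=> n c; exact: (symbol_sum_bound n ltr01 B0 B0 ds cs' (fun j x _ _ => sB j x)
  (fun j x _ => s'B j x)).
Qed.

(** The difference of two sums is split at the frequency J given by
    [symbol_sum_tail]: the part beyond J is small because the symbol is, and the
    part below J because it involves finitely many coefficients, each of which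
    converges. *)
Lemma symbol_sum_cauchy (deg : nat -> nat) (c : nat -> nat -> R[i])
    (l : nat -> R[i]) W :
  (forall n j, (deg n <= j)%N -> c n j = 0) ->
  (forall n, \sum_(j < deg n) sqnorm (c n j) <= W) ->
  (forall J e, 0 < e -> exists N, forall n j, (N <= n)%N -> (j < J)%N ->
     sqnorm (c n j - l j) <= e) ->
  sqint_cauchy mu (fun n => symbol_sum (deg n) (c n)).
Proof.
move=> c0 cW cl e e0.
have widen n L : (deg n <= L)%N -> symbol_sum L (c n) = symbol_sum (deg n) (c n).
  move=> nL; apply/funext => x; rewrite /symbol_sum.
  rewrite (big_ord_widen L (fun j => c n j * (s j x * mode j x)) nL).
  rewrite [LHS](bigID (fun j : 'I_L => (j < deg n)%N)) /=.
  rewrite [X in _ + X]big1 ?addr0// => j; rewrite -leqNgt => nj.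
  by rewrite c0// mul0r.
have widenW n L : (deg n <= L)%N -> \sum_(j < L) sqnorm (c n j) <= W.
  move=> nL; apply: le_trans (cW n).
  rewrite (big_ord_widen L (fun j => sqnorm (c n j)) nL).
  rewrite [leLHS](bigID (fun j : 'I_L => (j < deg n)%N)) /=.
  rewrite [X in _ + X]big1 ?addr0// => j; rewrite -leqNgt => nj.
  by rewrite c0// sqnorm0.
have W0 : 0 <= W by apply: le_trans (cW 0%N); apply: sumr_ge0 => j _; exact: sqnorm_ge0.
(* eta and tau are chosen so that each of the two parts contributes at most
   e/2; the differences of coefficients have sum of squares at most 4 W. *)
pose eta := e / (16 * W + 16).
have eta0 : 0 < eta by rewrite divr_gt0//; lra.
have [J HJ] := symbol_sum_tail eta0.
have [Q [Q0 HQ]] := symbol_sum_bounded.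
pose tau := e / (16 * (Q * J%:R + 1)).
have QJ0 : 0 <= Q * J%:R by rewrite mulr_ge0.
have tau0 : 0 < tau by rewrite divr_gt0// mulr_gt0//; lra.
have [N HN] := cl J tau tau0.
exists N => m n Nm Nn.
pose L := maxn (deg m) (deg n).
pose L' := maxn L J.
have mL : (deg m <= L')%N by rewrite /L' /L !leq_max leqnn.
have nL : (deg n <= L')%N by rewrite /L' /L !leq_max leqnn orbT.
have JL : (J <= L')%N by rewrite /L' leq_max leqnn orbT.
pose d j := c m j - c n j.
pose dh j := if (j < J)%N then d j else 0.
pose dt j := if (j < J)%N then 0 else d j.
have E : (fun x => symbol_sum (deg m) (c m) x - symbol_sum (deg n) (c n) x) =
    (fun x => symbol_sum L' dt x + symbol_sum L' dh x).
  apply/funext => x; rewrite -(widen m L' mL) -(widen n L' nL) /symbol_sum.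
  rewrite -sumrB -big_split /=; apply: eq_bigr => j _.
  by rewrite /dt /dh; case: ifP => _; rewrite mul0r ?add0r ?addr0 mulrBl.
rewrite E; have ms k := ccontinuous_measurable (symbol_sum_continuous L' k).
apply: (le_trans (sqintD_le mu (ms dt) (ms dh))).
have sumd : \sum_(j < L') sqnorm (d j) <= 4 * W.
  apply: (@le_trans _ _ (\sum_(j < L') (2 * sqnorm (c m j) + 2 * sqnorm (c n j)))).
    apply: ler_sum => j _; rewrite -[sqnorm (c n j)]sqnormN.
    exact: sqnormD_le.
  rewrite big_split /= -!mulr_sumr.
  have := widenW m L' mL; have := widenW n L' nL; lra.
have sumdt : \sum_(j < L') sqnorm (dt j) <= 4 * W.
  apply: le_trans sumd; apply: ler_sum => j _; rewrite /dt; case: ifP => // _.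
  by rewrite sqnorm0 sqnorm_ge0.
have sumdh : \sum_(j < L') sqnorm (dh j) <= J%:R * (4 * tau).
  have -> : \sum_(j < L') sqnorm (dh j) = \sum_(j < J) sqnorm (d j).
    rewrite (big_ord_widen L' (fun j => sqnorm (d j)) JL) [RHS]big_mkcond /=.
    by apply: eq_bigr => j _; rewrite /dh; case: ifP => // _; rewrite sqnorm0.
  apply: (@le_trans _ _ (\sum_(j < J) (4 * tau))).
    apply: ler_sum => j _.
    have -> : d j = (c m j - l j) + (l j - c n j) by rewrite addrA subrK.
    apply: (le_trans (sqnormD_le _ _)); rewrite [sqnorm (l j - _)]sqnorm_distC.
    have := HN m j Nm (ltn_ord j); have := HN n j Nn (ltn_ord j); lra.
  by rewrite sumr_const card_ord -[leLHS]mulr_natl.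
have two0 : (0 <= 2%:E :> \bar R)%E by rewrite lee_fin.
have ht : (sqint mu (symbol_sum L' dt) <= (eta * (4 * W))%:E)%E.
  apply: (le_trans (HJ L' dt _)); first by move=> j jJ; rewrite /dt jJ.
  by rewrite lee_fin ler_wpM2l// ltW.
have hh : (sqint mu (symbol_sum L' dh) <= (Q * (J%:R * (4 * tau)))%:E)%E.
  by apply: (le_trans (HQ L' dh)); rewrite lee_fin ler_wpM2l.
apply: (le_trans (leeD (lee_wpmul2l two0 ht) (lee_wpmul2l two0 hh))).
rewrite -!EFinM -EFinD lee_fin.
have -> : 2 * (eta * (4 * W)) = e / 2 * (W / (W + 1)) by rewrite /eta; field; lra.
have -> : 2 * (Q * (J%:R * (4 * tau))) = e / 2 * (Q * J%:R / (Q * J%:R + 1)).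
  by rewrite /tau; field; lra.
have e20 : 0 <= e / 2 by lra.
have W1 : W / (W + 1) <= 1 by rewrite ler_pdivrMr ?mul1r; lra.
have QJ1 : Q * J%:R / (Q * J%:R + 1) <= 1 by rewrite ler_pdivrMr ?mul1r; lra.
have := ler_piMr e20 W1; have := ler_piMr e20 QJ1; lra.
Qed.

End Sufficiency.

Section Compactness.
Context {R : realType}.
Local Notation mu := (@torus_measure R).

(** The n-th term u n is replaced by a trigonometric polynomial P n with
    int |u n - P n|^2 <= 1 / (n+1).  The real and imaginary parts of the
    coefficients of P n are interleaved in the rows a n, to which the diagonal
    extraction applies; w n is the image of P n. *)
Lemma small_symbol_compact (sigma : R -> int -> R[i])
    (T : (R -> R[i]) -> (R -> R[i])) (B : R) :
  bounded_extension sigma T ->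
  (forall k, is_cderive (sigma ^~ k) (cderiv 1 (sigma ^~ k))) ->
  (forall k, ccontinuous (cderiv 1 (sigma ^~ k))) ->
  0 <= B -> (forall x k, sqnorm (sigma x k) <= B) ->
  (forall x k, sqnorm (cderiv 1 (sigma ^~ k) x) <= B) ->
  symbol_limsup sigma = 0%E -> compact_operator T.
Proof.
move=> hT ds cs' B0 sB s'B /symbol_limsup_eq0 small u uL [C0 uC].
have pi0 := pi_gt0 R.
have two0 : (0 <= 2%:E :> \bar R)%E by rewrite lee_fin.
have smallj e : 0 < e -> exists J, forall j x, (J <= j)%N ->
    - pi <= x <= pi -> sqnorm (sigma x (freq j)) <= e.
  move=> e0; have [N HN] := small e e0; exists N.*2 => j x Jj xD.
  by apply: HN => //; exact: freq_large.
have [TinL2 _ _] := hT.1.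
have [C [CC0 TC]] := sqint_bounded_operator hT.1.
have approx n : exists p : nat * (nat -> R[i]),
    (forall j, (p.1 <= j)%N -> p.2 j = 0) /\
    (sqint mu (fun x => (u n x - trig_poly p.1 p.2 x)%R) <= (n.+1%:R^-1)%:E)%E.
  have [|p [[d [c [c0 ->]]] H]] := trig_approx_L2 (uL n) (e := n.+1%:R^-1).
    by rewrite invr_gt0.
  by exists (d, c).
have [p Hp] := choice approx.
pose deg n := (p n).1; pose c n := (p n).2.
have c0 n j : (deg n <= j)%N -> c n j = 0 by have [H _] := Hp n; exact: H.
pose P n := trig_poly (deg n) (c n).
have uP n : (sqint mu (fun x => (u n x - P n x)%R) <= (n.+1%:R^-1)%:E)%E.
  by have [_] := Hp n.
have PL n : inL2 (P n) by apply: (@inL2_sum _ (deg n) (c n) mode) => j; exact: inL2_expi.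
have mu_ n := inL2_measurable (uL n); have mP n := inL2_measurable (PL n).
pose W := (2 * C0 ^+ 2 + 2) / (2 * pi).
have W0 : 0 <= W.
  by apply: divr_ge0; [rewrite addr_ge0// mulr_ge0// sqr_ge0|lra].
have cW n : \sum_(j < deg n) sqnorm (c n j) <= W.
  have := sqintB_le mu (mu_ n) (measurable_cfunB (mu_ n) (mP n)).
  rewrite (_ : (fun x => _) = P n); last by apply/funext => x; rewrite subKr.
  have h1 := normL2_le (uC n).
  have h2 : (sqint mu (fun x => (u n x - P n x)%R) <= 1%:E)%E.
    by apply: (le_trans (uP n)); rewrite lee_fin invf_le1// ler1n.
  move=> H; have {H} := le_trans H (leeD (lee_wpmul2l two0 h1) (lee_wpmul2l two0 h2)).
  rewrite sqint_trig_poly -!EFinM -EFinD lee_fin mulr1 => H.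
  by rewrite /W ler_pdivlMr 1?mulrC//; lra.
have cj n j : sqnorm (c n j) <= W.
  have [jn|nj] := ltnP j (deg n); last by rewrite c0// sqnorm0.
  apply: le_trans (cW n); rewrite (bigD1 (Ordinal jn)) //= lerDl.
  by apply: sumr_ge0 => i _; exact: sqnorm_ge0.
pose a n i := if odd i then complex.Im (c n i./2) else complex.Re (c n i./2).
have aM n i : `|a n i| <= W + 1.
  have H : a n i ^+ 2 <= W.
    apply: le_trans (cj n i./2); rewrite /a /sqnorm.
    by case: ifP => _; rewrite ?lerDl ?lerDr sqr_ge0.
  have := sqr_ge0 (`|a n i| - 1); have := real_normK (num_real (a n i)); nra.
have [phi [l [phi_inc al]]] := diagonal_subsequence aM.
pose lc j : R[i] := l j.*2 +i* l j.*2.+1.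
have cl J e : 0 < e -> exists N, forall n j, (N <= n)%N -> (j < J)%N ->
    sqnorm (c (phi n) j - lc j) <= e.
  move=> e0; have t0 : 0 < Num.sqrt (e / 2) by rewrite sqrtr_gt0; lra.
  have [N HN] := al J.*2 _ t0; exists N => n j Nn jJ.
  have hr := HN n j.*2 Nn; rewrite ltn_double in hr.
  have hi := HN n j.*2.+1 Nn; rewrite ltn_Sdouble in hi.
  move: (hr jJ) (hi jJ); rewrite /a /= odd_double /= doubleK uphalf_double /lc /sqnorm.
  have sq (t : R) : `|t| <= Num.sqrt (e / 2) -> t ^+ 2 <= e / 2.
    move=> ht; rewrite -(real_normK (num_real t)) -(@sqr_sqrtr _ (e / 2)); last by lra.
    by rewrite ler_pXn2r ?nnegrE ?sqrtr_ge0.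
  case: (c (phi n) j) => x y /= /sq h1 /sq h2; lra.
pose s j := sigma ^~ (freq j).
pose s' j := cderiv 1 (sigma ^~ (freq j)).
pose w n := symbol_sum s (deg n) (c n).
have wT n : eqL2 (T (P n)) (w n) := operator_trig hT (deg n) (c n).
have mw n : measurable_cfun (w n).
  apply/ccontinuous_measurable.
  by apply: (@symbol_sum_continuous _ s s') => j; exact: ds.
have cauchy_w : sqint_cauchy mu (fun n => w (phi n)).
  apply: (@symbol_sum_cauchy _ s s' B _ _ B0 _ _ smallj (deg \o phi) (c \o phi) lc W).
  - by move=> j; exact: ds.
  - by move=> j; exact: cs'.
  - by move=> j x; exact: sB.
  - by move=> j x; exact: s'B.
  - by move=> n j; exact: c0.
  - by move=> n; exact: cW.
  - exact: cl.
have [g [mg wg]] := @sqint_complete _ _ R mu _ (fun n => mw (phi n)) cauchy_w.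
have phi_ge n : (n <= phi n)%N.
  elim: n => // n IHn; apply: (leq_ltn_trans IHn).
  by have /increasing_seqP := phi_inc; apply.
have gL : inL2 g.
  apply/inL2P; split=> //; have [N HN] := wg 1 ltr01.
  have := sqintB_le mu (mw (phi N)) (measurable_cfunB (mw (phi N)) mg).
  rewrite (_ : (fun x => _) = g); last by apply/funext => x; rewrite subKr.
  move=> /le_lt_trans; apply; rewrite lte_add_pinfty// lte_mul_pinfty//.
    rewrite -(@ae_eq_sqint _ _ _ mu _ _ _ (mw (phi N)) (wT (phi N))).
      by have /inL2P[_] := TinL2 _ (PL (phi N)).
    by apply: inL2_measurable; exact: TinL2.
  by apply: (le_lt_trans (HN N (leqnn _))); exact: ltry.
exists phi, g; split => //.
apply/(normL2_cvg0 (fun n => TinL2 _ (uL (phi n))) gL) => e e0.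
have e4 : 0 < e / 4 by lra.
have [N HN] := wg _ e4.
exists (maxn N (Num.bound (4 * C / e))) => n; rewrite geq_max => /andP[Nn Cn].
have mTu := inL2_measurable (TinL2 _ (uL (phi n))).
have mTP := inL2_measurable (TinL2 _ (PL (phi n))).
have Tuw : (sqint mu (fun x => (T (u (phi n)) x - w (phi n) x)%R) <= (e / 4)%:E)%E.
  have uPL := inL2B (uL (phi n)) (PL (phi n)).
  have -> : sqint mu (fun x => T (u (phi n)) x - w (phi n) x) =
      sqint mu (T (fun x => u (phi n) x - P (phi n) x)).
    apply: ae_eq_sqint.
    - exact: (measurable_cfunB mTu (mw (phi n))).
    - by apply: inL2_measurable; exact: TinL2.
    - have H := operatorB hT.1 (uL (phi n)) (PL (phi n)).
      apply: (@filterS _ _ ae_filter_torus _ _ _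
        (@filterI _ _ ae_filter_torus _ _ H (wT (phi n)))) => x [-> ->].
      by [].
  apply: (le_trans (TC _ uPL)).
  apply: (@le_trans _ _ (C%:E * ((phi n).+1%:R^-1)%:E)%E); first by apply: lee_wpmul2l.
  rewrite -EFinM lee_fin ler_pdivrMr//.
  have e0' : 0 < e := e0.
  have : 4 * C / e <= (phi n).+1%:R.
    rewrite ltW// (@lt_le_trans _ _ (Num.bound (4 * C / e))%:R)//.
      by rewrite archi_boundP// divr_ge0 ?mulr_ge0// ltW.
    by rewrite ler_nat (leq_trans Cn)// ltnW// ltnS.
  rewrite ler_pdivrMr//; lra.
have := sqintD_le mu (measurable_cfunB mTu (mw (phi n))) (measurable_cfunB (mw (phi n)) mg).
rewrite (_ : (fun x => _ + _) = (fun x => T (u (phi n)) x - g x)); last first.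
  by apply/funext => x; rewrite addrA subrK.
move=> /le_trans; apply.
apply: (le_trans (leeD (lee_wpmul2l two0 Tuw) (lee_wpmul2l two0 (HN n Nn)))).
by rewrite -!EFinM -EFinD lee_fin; lra.
Qed.

End Compactness.

Theorem theorem4p7 (R : realType) (Lambda : int -> R) (mu0 mu1 mu rho : R)
    (hLambda : weight_function Lambda mu0 mu1 mu)
    (hrho : 0 < rho <= mu^-1)
    (sigma : R -> int -> R[i]) (hsigma : symbolM Lambda rho 0 sigma)
    (T : (R -> R[i]) -> (R -> R[i])) (hT : bounded_extension sigma T) :
  compact_operator T <-> symbol_limsup sigma = 0%E.
Proof.
have [ds cs' [B [B0 sB s'B]]] := symbol_bounds hsigma.
split; first exact: compact_symbol_limsup hT ds cs' s'B B0.
exact: small_symbol_compact hT ds cs' B0 sB s'B.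
Qed.
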